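(* Let $K$ be an algebraic number field and let $v$ be a prime (finite or infinite) of $K$ such that $\varepsilon\in K_v$, where $\varepsilon$ is a primitive cubic root of unity. Let $\alpha\in K^*$, $\beta\in K_v^*$, and let $L=K(\sqrt[3]{\alpha})$. The following statements are equivalent: (i) The symbol algebra $A=\left(\frac{\alpha,\beta}{K_v,\varepsilon}\right)$ is a division algebra. (ii) $\beta\notin N_{L_w/K_v}(L_w^* )$ for each prime $w$ of $L$ lying above $v$.
   Context: A prime of a number field $K$ is an equivalence class of valuations of $K$ (finite primes correspond to nonzero prime ideals of the ring of integers, infinite primes to embeddings into $\mathbb{C}$). $K_v$ denotes the completion of $K$ at $v$, $L_w$ the completion of $L$ at $w$, and $N_{L_w/K_v}$ the norm map. For a field $F$ containing a primitive cubic root of unity $\varepsilon$ and $\alpha,\beta\in F^*$, the symbol algebra $\left(\frac{\alpha,\beta}{F,\varepsilon}\right)$ is the unital associative $F$-algebra generated by $x,y$ with relations $x^3=\alpha$, $y^3=\beta$, $yx=\varepsilon xy$ (of dimension $9$ over $F$). A finite-dimensional nonzero algebra is a division algebra if and only if it has no zero divisors. *)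

(* Defs.v *)
From HB Require Import structures.
From mathcomp Require Import all_boot all_order all_algebra all_field.
From mathcomp Require Import zify ring reals exp.

Set Implicit Arguments.
Unset Strict Implicit.
Unset Printing Implicit Defensive.

Import Order.TTheory GRing.Theory Num.Theory.
Local Open Scope ring_scope.

(* The entry (i, j) of an element is its coefficient on x^i y^j.  Since
   y x = eps x y, one has y^j x^k = eps^(j k) x^k y^j, whence
   (x^i y^j) (x^k y^l) = eps^(j k) x^(i+k) y^(j+l), and x^3 = alpha, y^3 = beta
   bring the exponents i+k and j+l back below 3. *)
Definition symbol_algebra (F : fieldType) (alpha beta eps : F)
  (eps_prim : 3.-primitive_root eps) : Type := 'rV[F]_(3 * 3).

Section SymbolAlgebra.

Variables (F : fieldType) (alpha beta eps : F).
Hypothesis eps_prim : 3.-primitive_root eps.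

Notation A := (symbol_algebra alpha beta eps_prim).

HB.instance Definition _ := Vector.copy A 'rV[F]_(3 * 3).

Definition symbol_coef (p q : 'I_3 * 'I_3) : F :=
  eps ^+ (p.2 * q.1) * alpha ^+ ((p.1 + q.1)%N %/ 3)
    * beta ^+ ((p.2 + q.2)%N %/ 3).

Definition symbol_entry (a : A) (p : 'I_3 * 'I_3) : F := vec_mx a p.1 p.2.

Definition symbol_basis (p : 'I_3 * 'I_3) : A := mxvec (delta_mx p.1 p.2).

(* p + q is the sum modulo 3. *)
Definition symbol_mul (a b : A) : A :=
  \sum_(p : 'I_3 * 'I_3) \sum_(q : 'I_3 * 'I_3)
    (symbol_entry a p * symbol_entry b q * symbol_coef p q)
      *: symbol_basis (p.1 + q.1, p.2 + q.2).

Definition symbol_one : A := symbol_basis (0, 0).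

Lemma symbol_entry_basis p q : symbol_entry (symbol_basis p) q = (q == p)%:R.
Proof. by rewrite /symbol_entry mxvecK mxE -pair_eqE. Qed.

Lemma symbol_entryP k a b p :
  symbol_entry (k *: a + b) p = k * symbol_entry a p + symbol_entry b p.
Proof. by rewrite /symbol_entry linearP !mxE. Qed.

Lemma symbol_basisE (a : A) :
  a = \sum_(p : 'I_3 * 'I_3) symbol_entry a p *: symbol_basis p.
Proof.
rewrite -[LHS]vec_mxK [X in mxvec X]matrix_sum_delta pair_bigA /= linear_sum.
by apply: eq_bigr => p _; rewrite linearZ.
Qed.

Fact symbol_mul_linear a : linear (symbol_mul a).
Proof.
move=> k b c; rewrite /symbol_mul scaler_sumr -big_split; apply: eq_bigr => p _.
rewrite /= scaler_sumr -big_split; apply: eq_bigr => q _ /=.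
by rewrite scalerA -scalerDl symbol_entryP; congr (_ *: _); ring.
Qed.
HB.instance Definition _ a :=
  GRing.isLinear.Build F A A *:%R (symbol_mul a) (symbol_mul_linear a).

Definition symbol_mulr b a := symbol_mul a b.

Fact symbol_mulr_linear b : linear (symbol_mulr b).
Proof.
move=> k a c; rewrite /symbol_mulr /symbol_mul scaler_sumr -big_split.
apply: eq_bigr => p _; rewrite /= scaler_sumr -big_split; apply: eq_bigr => q _ /=.
by rewrite scalerA -scalerDl symbol_entryP; congr (_ *: _); ring.
Qed.
HB.instance Definition _ b :=
  GRing.isLinear.Build F A A *:%R (symbol_mulr b) (symbol_mulr_linear b).

Lemma symbol_mul_basis p q : symbol_mul (symbol_basis p) (symbol_basis q)
  = symbol_coef p q *: symbol_basis (p.1 + q.1, p.2 + q.2).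
Proof.
rewrite /symbol_mul (bigD1 p) //= (bigD1 q) //= !symbol_entry_basis !eqxx !mul1r.
rewrite big1 ?addr0 => [|s /negPf neq_sq]; last first.
  by rewrite symbol_entry_basis neq_sq mulr0 mul0r scale0r.
rewrite big1 ?addr0 // => r /negPf neq_rp; rewrite big1 // => s _.
by rewrite symbol_entry_basis neq_rp !mul0r scale0r.
Qed.

Lemma symbol_coefA p q r :
  symbol_coef p q * symbol_coef (p.1 + q.1, p.2 + q.2) r
  = symbol_coef q r * symbol_coef p (q.1 + r.1, q.2 + r.2).
Proof.
case: p q r => [i j] [k l] [m n]; rewrite /symbol_coef /=.
have carry (a b c : 'I_3) (z : F) :
  z ^+ ((a + b)%N %/ 3) * z ^+ (((a + b) %% 3 + c)%N %/ 3)
  = z ^+ ((b + c)%N %/ 3) * z ^+ ((a + (b + c) %% 3)%N %/ 3).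
  rewrite -!exprD; congr (_ ^+ _); move: a b c.
  by do 3![case; case=> [|[|[|?]]] // ?].
have epsX (a b : nat) : eps ^+ (a %% 3 * b) = eps ^+ (a * b).
  by rewrite -(prim_expr_mod eps_prim) modnMml (prim_expr_mod eps_prim).
have epsXr (a b : nat) : eps ^+ (a * (b %% 3)) = eps ^+ (a * b).
  by rewrite mulnC epsX mulnC.
have E : eps ^+ (j * k) * eps ^+ ((j + l) %% 3 * m)
  = eps ^+ (l * m) * eps ^+ (j * ((k + m) %% 3)).
  by rewrite epsX epsXr -!exprD; congr (_ ^+ _); rewrite mulnDl mulnDr; lia.
have Ea := carry i k m alpha; have Eb := carry j l n beta.
rewrite mulrACA [in LHS](mulrACA (eps ^+ _)) [RHS]mulrACA [in RHS](mulrACA (eps ^+ _)).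
by congr (_ * _ * _).
Qed.

Let mul_suml I r (P : pred I) (f : I -> A) b :
  symbol_mul (\sum_(i <- r | P i) f i) b = \sum_(i <- r | P i) symbol_mul (f i) b.
Proof. exact: (linear_sum (symbol_mulr b)). Qed.

Let mulZl k a b : symbol_mul (k *: a) b = k *: symbol_mul a b.
Proof. exact: (linearZZ (symbol_mulr b)). Qed.

Let mul_sumr I r (P : pred I) (f : I -> A) a :
  symbol_mul a (\sum_(i <- r | P i) f i) = \sum_(i <- r | P i) symbol_mul a (f i).
Proof. exact: linear_sum. Qed.

Let mulZr k a b : symbol_mul a (k *: b) = k *: symbol_mul a b.
Proof. exact: linearZZ. Qed.

Fact symbol_mulA : associative symbol_mul.
Proof.
move=> a b c; rewrite (symbol_basisE a) (symbol_basisE b) (symbol_basisE c).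
move: symbol_mul mul_suml mul_sumr mulZl mulZr symbol_mul_basis => mul sl sr Zl Zr mulE.
rewrite !sl; apply: eq_bigr => p _; rewrite [LHS]sr [X in mul X _]sr sl.
apply: eq_bigr => q _.
rewrite !sr; apply: eq_bigr => r _; rewrite !(Zl, Zr) !mulE !(Zl, Zr) !mulE.
rewrite !scalerA /= !addrA; congr (_ *: _).
by ring: (symbol_coefA p q r).
Qed.

Fact symbol_mul1l : left_id symbol_one symbol_mul.
Proof.
move=> a; rewrite [in LHS](symbol_basisE a) linear_sum [RHS]symbol_basisE.
apply: eq_bigr => -[i j] _; rewrite linearZ /= symbol_mul_basis /= !add0r.
by rewrite /symbol_coef /= mul0n !add0n !divn_small // !expr0 !mulr1 scale1r.
Qed.

Fact symbol_mul1r : right_id symbol_one symbol_mul.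
Proof.
move=> a; rewrite [in LHS](symbol_basisE a) mul_suml [RHS]symbol_basisE.
apply: eq_bigr => -[i j] _; rewrite mulZl /= symbol_mul_basis /= !addr0.
by rewrite /symbol_coef /= muln0 !addn0 !divn_small // !expr0 !mulr1 scale1r.
Qed.

Fact symbol_mulDl : left_distributive symbol_mul +%R.
Proof. by move=> a b c; exact: (linearD (symbol_mulr c)). Qed.

Fact symbol_mulDr : right_distributive symbol_mul +%R.
Proof. by move=> a b c; exact: linearD. Qed.

Fact symbol_one_neq0 : symbol_one != 0.
Proof.
apply/eqP => /(congr1 (symbol_entry^~ (0, 0))) /eqP.
by rewrite symbol_entry_basis eqxx /symbol_entry linear0 mxE oner_eq0.
Qed.

HB.instance Definition _ := GRing.Zmodule_isNzRing.Build A
  symbol_mulA symbol_mul1l symbol_mul1r symbol_mulDl symbol_mulDr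
  symbol_one_neq0.

Fact symbol_scalerAl (k : F) (a b : A) : k *: (a * b) = k *: a * b.
Proof. exact: (esym (mulZl k a b)). Qed.

HB.instance Definition _ := GRing.Lmodule_isLalgebra.Build F A symbol_scalerAl.

Fact symbol_scalerAr (k : F) (a b : A) : k *: (a * b) = a * (k *: b).
Proof. exact: (esym (mulZr k a b)). Qed.

HB.instance Definition _ := GRing.Lalgebra_isAlgebra.Build F A symbol_scalerAr.
HB.instance Definition _ := Algebra_isFalgebra.Build F A.

Definition symbol_x : A := symbol_basis (1, 0).
Definition symbol_y : A := symbol_basis (0, 1).

Lemma symbol_basisM p q : symbol_basis p * symbol_basis q
  = symbol_coef p q *: symbol_basis (p.1 + q.1, p.2 + q.2).
Proof. exact: symbol_mul_basis. Qed.

Let coefE i j k m n l p q : symbol_coef p q = eps ^+ i * alpha ^+ j * beta ^+ k ->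
  (p.1 + q.1, p.2 + q.2) = (m, n) -> eps ^+ i * alpha ^+ j * beta ^+ k = l ->
  symbol_basis p * symbol_basis q = l *: symbol_basis (m, n).
Proof. by move=> e1 e2 e3; rewrite symbol_basisM e1 e2 e3. Qed.

Lemma symbol_x3 : symbol_x ^+ 3 = alpha%:A.
Proof.
have xx : symbol_x * symbol_x = 1 *: symbol_basis (2%:R, 0).
  by apply: (@coefE 0 0 0); [| congr pair; apply: val_inj | rewrite !expr0 !mul1r].
rewrite !exprS expr0 mulr1 xx scale1r.
by apply: (@coefE 0 1 0); [| congr pair; apply: val_inj | rewrite !expr0 mul1r mulr1].
Qed.

Lemma symbol_y3 : symbol_y ^+ 3 = beta%:A.
Proof.
have yy : symbol_y * symbol_y = 1 *: symbol_basis (0, 2%:R).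
  by apply: (@coefE 0 0 0); [| congr pair; apply: val_inj | rewrite !expr0 !mul1r].
rewrite !exprS expr0 mulr1 yy scale1r.
by apply: (@coefE 0 0 1); [| congr pair; apply: val_inj | rewrite !expr0 !mul1r].
Qed.

Lemma symbol_yx : symbol_y * symbol_x = eps *: (symbol_x * symbol_y).
Proof.
have -> : symbol_x * symbol_y = 1 *: symbol_basis (1, 1).
  by apply: (@coefE 0 0 0); [| congr pair; apply: val_inj | rewrite !expr0 !mul1r].
rewrite scale1r.
by apply: (@coefE 1 0 0); [| congr pair; apply: val_inj | rewrite !expr0 !mulr1].
Qed.

Lemma symbol_basis_xy p : symbol_basis p = symbol_x ^+ p.1 * symbol_y ^+ p.2.
Proof.
have xi (i : 'I_3) : symbol_x ^+ i = symbol_basis (i, 0).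
  case: i => i; elim: i => [|i IHi] lti.
    by rewrite expr0; congr symbol_basis; congr pair; apply: val_inj.
  rewrite exprS (IHi (ltnW lti)) -[RHS]scale1r.
  apply: (@coefE 0 0 0); last by rewrite !expr0 !mul1r.
    by congr (_ * _ ^+ _ * _); rewrite /= divn_small.
  by congr pair; apply: val_inj; rewrite /= modn_small.
have yj (j : 'I_3) : symbol_y ^+ j = symbol_basis (0, j).
  case: j => j; elim: j => [|j IHj] ltj.
    by rewrite expr0; congr symbol_basis; congr pair; apply: val_inj.
  rewrite exprS (IHj (ltnW ltj)) -[RHS]scale1r.
  apply: (@coefE 0 0 0); last by rewrite !expr0 !mul1r.
    by congr (_ * _ * _ ^+ _); rewrite /= divn_small.
  by congr pair; apply: val_inj; rewrite /= modn_small.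
case: p => i j; rewrite /= xi yj -[LHS]scale1r; apply/esym.
apply: (@coefE 0 0 0); last by rewrite !expr0 !mul1r.
  by rewrite /symbol_coef /= addn0 add0n !divn_small.
by rewrite /= addr0 add0r.
Qed.

Lemma symbol_algebra_generated (a : A) :
  a = \sum_(p : 'I_3 * 'I_3)
        symbol_entry a p *: (symbol_x ^+ p.1 * symbol_y ^+ p.2).
Proof.
by rewrite [LHS]symbol_basisE; apply: eq_bigr => p _; rewrite symbol_basis_xy.
Qed.

Lemma dim_symbol_algebra : \dim {:A} = 9.
Proof. by rewrite dimvf. Qed.

Lemma symbol_algebra_presentation (B : algType F) (u v : B) :
  u ^+ 3 = alpha%:A -> v ^+ 3 = beta%:A -> v * u = eps *: (u * v) ->
  exists f : {lrmorphism A -> B}, f symbol_x = u /\ f symbol_y = v.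
Proof.
move=> u3 v3 vu.
pose w (p : 'I_3 * 'I_3) : B := u ^+ p.1 * v ^+ p.2.
pose f (a : A) : B := \sum_(p : 'I_3 * 'I_3) symbol_entry a p *: w p.
have fE p : f (symbol_basis p) = w p.
  rewrite /f (bigD1 p) //= symbol_entry_basis eqxx scale1r big1 ?addr0 // => q.
  by rewrite symbol_entry_basis => /negPf->; rewrite scale0r.
have f_lin : linear f.
  move=> k a b; rewrite /f scaler_sumr -big_split; apply: eq_bigr => p _ /=.
  by rewrite symbol_entryP scalerDl scalerA.
pose fL := GRing.isLinear.Build F A B *:%R f f_lin.
pose fl : {linear A -> B} := HB.pack f fL.
have vuX j k : v ^+ j * u ^+ k = eps ^+ (j * k) *: (u ^+ k * v ^+ j).
  have vu1 n : v * u ^+ n = eps ^+ n *: (u ^+ n * v).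
    elim: n => [|n IHn]; first by rewrite !expr0 mul1r mulr1 scale1r.
    rewrite [u ^+ _]exprS mulrA vu -scalerAl -[in LHS](mulrA u) IHn -scalerAr scalerA.
    by rewrite -[in LHS]exprS -[in RHS]mulrA.
  elim: j => [|j IHj]; first by rewrite mul0n !expr0 mul1r mulr1 scale1r.
  rewrite [v ^+ _]exprS -mulrA IHj -scalerAr !mulrA vu1 -scalerAl scalerA -exprD.
  by rewrite mulSn addnC.
have redX (z : B) c n : z ^+ 3 = c%:A -> z ^+ n = c ^+ (n %/ 3) *: z ^+ (n %% 3).
  move=> z3; rewrite {1}(divn_eq n 3) exprD mulnC exprM z3 exprZn expr1n.
  by rewrite -scalerAl mul1r.
have wM p q : w p * w q = symbol_coef p q *: w (p.1 + q.1, p.2 + q.2).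
  rewrite /w mulrA -(mulrA (u ^+ p.1)) vuX -scalerAr -scalerAl mulrA -exprD.
  rewrite -mulrA -exprD (redX u alpha (_ + _)%N) // (redX v beta (_ + _)%N) //=.
  by rewrite -scalerAl -scalerAr !scalerA.
have f_mul : monoid_morphism f.
  split; first by rewrite -[1]/(symbol_basis (0, 0)) fE /w !expr0 mulr1.
  move=> a b; rewrite [a * b]/(symbol_mul a b) /symbol_mul.
  rewrite -[LHS]/(fl _) linear_sum [f a]/f mulr_suml; apply: eq_bigr => p _.
  rewrite linear_sum [f b]/f mulr_sumr; apply: eq_bigr => q _.
  rewrite linearZ /= fE -scalerAl -scalerAr wM !scalerA; congr (_ *: _).
pose fM := GRing.isMonoidMorphism.Build A B f f_mul.
pose fr : {lrmorphism A -> B} := HB.pack f fL fM.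
exists fr; split; rewrite /= fE /w /=.
  by rewrite expr0 mulr1 expr1.
by rewrite expr0 mul1r expr1.
Qed.

End SymbolAlgebra.

Definition division_algebra (F : fieldType) (A : falgType F) : Prop :=
  forall a : A, a != 0 -> exists b : A, a * b = 1 /\ b * a = 1.

Definition field_norm (F : fieldType) (E : fieldExtType F) (x : E) : F :=
  \det (passmx.mxof (vbasis {:E}) (vbasis {:E}) (amull x)).

Section Primes.

Variable R : realType.

Definition absolute_value (F : fieldType) (v : F -> R) : Prop :=
  [/\ forall x, 0 <= v x,
      forall x, v x = 0 <-> x = 0,
      forall x y, v (x * y) = v x * v y
    & forall x y, v (x + y) <= v x + v y].

(* A prime is handled through a representative of its equivalence class: the
   non-archimedean ones are the finite primes, the archimedean ones the
   infinite primes. *)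
Definition prime_of (F : fieldType) (v : F -> R) : Prop :=
  absolute_value v /\ exists x, x != 0 /\ v x != 1.

Definition equivalent_abs (F : fieldType) (v1 v2 : F -> R) : Prop :=
  exists s : R, 0 < s /\ forall x, v1 x = v2 x `^ s.

Definition lies_above (F : fieldType) (E : fieldExtType F)
    (w : E -> R) (v : F -> R) : Prop :=
  equivalent_abs (fun x : F => w x%:A) v.

Definition cauchy_for (F : fieldType) (v : F -> R) (u : nat -> F) : Prop :=
  forall e : R, 0 < e ->
    exists N, forall m n, (N <= m)%N -> (N <= n)%N -> v (u m - u n) < e.

Definition converges_for (F : fieldType) (v : F -> R) (u : nat -> F) (l : F) :
    Prop :=
  forall e : R, 0 < e -> exists N, forall n, (N <= n)%N -> v (u n - l) < e.

Definition complete_for (F : fieldType) (v : F -> R) : Prop :=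
  forall u, cauchy_for v u -> exists l, converges_for v u l.

(* (Fv, av) together with iota : F -> Fv is a completion of F at v; it is unique
   up to a unique isomorphism. *)
Definition is_completion (F : fieldType) (v : F -> R)
    (Fv : fieldType) (av : Fv -> R) (iota : {rmorphism F -> Fv}) : Prop :=
  [/\ absolute_value av,
      forall x, av (iota x) = v x,
      forall (z : Fv) (e : R), 0 < e -> exists x, av (z - iota x) < e
    & complete_for av].

(* The structure map Kv -> Lw is the continuous extension of K -> L. *)
Definition is_local_extension (K : fieldType) (L : fieldExtType K)
    (Kv : fieldType) (av : Kv -> R) (iv : {rmorphism K -> Kv})
    (Lw : fieldExtType Kv) (aw : Lw -> R) (iw : {rmorphism L -> Lw}) : Prop :=
  (forall x : K, iw x%:A = (iv x)%:A) /\ lies_above aw av.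

End Primes.

(* Main.v *)
From HB Require Import structures.
Require Import Defs.
From mathcomp Require Import all_boot all_order all_algebra all_field.
From mathcomp Require Import ring lra.
From mathcomp Require Import boolp reals exp.
From mathcomp.real_closed Require Import complex.

(** The subalgebra [Kv[x]] of the symbol algebra [A] is the quotient of [Kv[X]]
    by [X^3 - alpha], and conjugation by [y] acts on it as the automorphism
    [x -> eps x]. The norm of [c0 + c1 x + c2 x^2], the product of its three
    conjugates, is the cubic form [nform], so that everything reduces to the
    question whether [beta] is a value of this form.

    If [beta = N(m)], then [y - m] is a zero divisor
    ([symbol_norm_not_division]); if [alpha = c^3], then [x - c] is one
    ([symbol_cube_not_division]). Conversely, let [alpha] be a non-cube and let
    [u] be a nonzero non-invertible element. Either [A u] or its left annihilator
    is a left ideal of dimension less than 6, in which some [y w] has to be of the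
    form [m w] with [m] in [Kv[x]]; applying [y] three times gives [beta = N(m)]
    ([symbol_not_division_norm]).

    It remains to recognize the norms from the completions of [L]. If [alpha] is a
    cube in [Kv], then [L] embeds into [Kv], so [Kv] is one of the completions and
    every [beta] is a norm ([cube_local_norm]), while [A] is not a division algebra.

    If [alpha] is not a cube, then [v] is ultrametric. Indeed, if [v] is
    archimedean, base [N] expansions embed the reals into [Kv]; since [2 eps + 1]
    is a square root of -3, the complex numbers embed as well, and [alpha], being
    algebraic over the rationals, lies in their image and has a cube root there
    ([archimedean_cube_root]). For an ultrametric [v], the cube root of the
    absolute value of the norm is an ultrametric complete absolute value on the
    cubic extension of [Kv]. The triangle inequality is the hard point; it follows
    from Hensel's lemma applied to the characteristic polynomial, which has no
    root ([rootless_cubic_bound], [nform_add1]). This makes the cubic extension a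
    completion of [L] ([noncube_local_norm]). Conversely, any completion [Lw]
    above [v] induces on its subfield [Kv(theta)] a power of the norm absolute
    value, by comparison of the growth of powers. The subfield is therefore
    complete; as it is also dense, it is all of [Lw]
    ([dense_pure_cubic_full]), and the norm of [Lw] is [nform]. *)

Set Implicit Arguments.
Unset Strict Implicit.
Unset Printing Implicit Defensive.
Import Order.TTheory GRing.Theory Num.Theory.
Local Open Scope ring_scope.

(** * Growth of real powers *)
Section Growth.
Variable R : realType.
Implicit Types a b c e r x : R.

Lemma bernoulli_expr b n : 1 <= b -> 1 + (b - 1) *+ n <= b ^+ n.
Proof.
move=> b1; elim: n => [|n IHn]; first by rewrite mulr0n addr0 expr0.
rewrite exprS; have : 0 <= (b - 1) *+ n by rewrite mulrn_wge0 ?subr_ge0.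
have := ler_wpM2l (le_trans ler01 b1) IHn.
rewrite mulrS; nra.
Qed.

Lemma expr_unbounded b x : 1 < b -> exists n, x < b ^+ n.
Proof.
move=> b1; have b1_gt0 : 0 < b - 1 by rewrite subr_gt0.
have := Num.Theory.archi_boundP (normr_ge0 (x / (b - 1))).
set n := Num.bound _ => lt_n; exists n.
apply: lt_le_trans (bernoulli_expr n (ltW b1)).
have : x / (b - 1) < n%:R by apply: le_lt_trans lt_n; apply: ler_norm.
by rewrite ltr_pdivrMr // mulr_natl => /lt_trans; apply; rewrite ltrDr ltr01.
Qed.

Lemma expr_small r e : 0 <= r < 1 -> 0 < e -> exists n, r ^+ n < e.
Proof.
case/andP; rewrite le_eqVlt => /predU1P[<- _ e0|r0 r1 e0].
  by exists 1; rewrite expr1.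
have [n lt_n] := @expr_unbounded r^-1 e^-1 (etrans (invf_gt1 r0) r1).
by exists n; move: lt_n; rewrite exprVn ltf_pV2 ?qualifE /= ?exprn_gt0.
Qed.

(** Taking n-th roots kills every factor of subexponential growth. *)
Lemma ler_of_expr_bound a b c :
  0 <= a -> 0 <= b -> 0 <= c -> (forall n, a ^+ n <= c * n.+1%:R * b ^+ n) -> a <= b.
Proof.
move=> a0 b0 c0 H; rewrite leNgt; apply/negP => ltba.
have a_gt0 : 0 < a by apply: le_lt_trans ltba.
move: b0; rewrite le_eqVlt => /predU1P[b0|b0].
  by have := H 1; rewrite -b0 expr0n mulr0 expr1 leNgt a_gt0.
pose d := a / b; have d1 : 1 < d by rewrite ltr_pdivlMr ?mul1r.
have Hd n : d ^+ n <= c * n.+1%:R.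
  by rewrite exprMn exprVn ler_pdivrMr ?exprn_gt0.
pose h := d - 1; have h0 : 0 < h by rewrite subr_gt0.
(* [d ^ (2n) >= (1 + nh)^2] grows quadratically in n *)
have [m mP] : exists m : nat, 2 * c / h ^+ 2 < m%:R.
  exists (Num.bound (2 * c / h ^+ 2)); apply: Num.Theory.archi_boundP.
  by rewrite divr_ge0 ?mulr_ge0 ?exprn_ge0 // ltW.
have := Hd (m.+1 * 2)%N; rewrite exprM leNgt => /negP; apply.
have B := bernoulli_expr m.+1 (ltW d1).
have B2 : (1 + h *+ m.+1) ^+ 2 <= (d ^+ m.+1) ^+ 2.
  by apply: lerXn2r B; rewrite qualifE /= ?exprn_ge0 ?addr_ge0 ?mulrn_wge0 ?divr_ge0 // ltW.
apply: lt_le_trans B2.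
rewrite -mulr_natl; move: mP; rewrite ltr_pdivrMr ?exprn_gt0 // => mP.
have m0 : 0 <= m%:R :> R by [].
rewrite -[(_ * 2).+1]addn1 natrD natrM -natr1.
rewrite expr2 in mP.
set M : R := m%:R in m0 mP *. rewrite expr2.
have h2 : 0 < h * h by exact: mulr_gt0.
have cM : 2 * c * (M + 1) <= M * (h * h) * (M + 1).
  by apply: ler_wpM2r (ltW mP); rewrite addr_ge0.
have hM : 0 <= h * M by rewrite mulr_ge0 // ltW.
have hhM : 0 <= h * h * M by rewrite mulr_ge0 // ltW.
nra.
Qed.

End Growth.

Lemma powR_exprn (R : realType) (x s : R) m : 0 <= x ->
  (x `^ s) ^+ m = (x ^+ m) `^ s.
Proof. by move=> x0; rewrite -(powR_mulrn m (powR_ge0 x s)) powRAC (powR_mulrn m x0). Qed.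

Lemma powR_invr (R : realType) (x s : R) : 0 <= x -> (x^-1) `^ s = (x `^ s)^-1.
Proof. by move=> x0; rewrite -(powR_inv1 x0) powRAC (powR_inv1 (powR_ge0 x s)). Qed.

(** * Absolute values *)
Section AbsoluteValue.
Variables (R : realType) (F : fieldType) (v : F -> R).
Hypothesis vP : absolute_value v.
Implicit Types x y z : F.

Lemma abs_ge0 x : 0 <= v x. Proof. by case: vP. Qed.

Lemma abs_eq0 x : (v x == 0) = (x == 0).
Proof. by case: vP => _ v0 _ _; apply/eqP/eqP => /v0. Qed.

Lemma abs0 : v 0 = 0. Proof. by apply/eqP; rewrite abs_eq0. Qed.

Lemma abs_gt0 x : (0 < v x) = (x != 0).
Proof. by rewrite lt_def abs_ge0 andbT abs_eq0. Qed.

Lemma absM x y : v (x * y) = v x * v y. Proof. by case: vP. Qed.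

Lemma absD x y : v (x + y) <= v x + v y. Proof. by case: vP. Qed.

Lemma abs1 : v 1 = 1.
Proof.
have v1 : v 1 != 0 by rewrite abs_eq0 oner_eq0.
by apply: (mulfI v1); rewrite -absM !mulr1.
Qed.

Lemma absX x n : v (x ^+ n) = v x ^+ n.
Proof.
elim: n => [|n IHn]; first by rewrite !expr0 abs1.
by rewrite !exprS absM IHn.
Qed.

Lemma abs_root1 x n : x ^+ n.+1 = 1 -> v x = 1.
Proof.
move=> /(congr1 v) /eqP; rewrite absX abs1 => xn1.
by apply/eqP; rewrite -(@pexpr_eq1 _ _ n.+1) ?abs_ge0.
Qed.

Lemma absN x : v (- x) = v x.
Proof. by rewrite -mulN1r absM (@abs_root1 _ 1) ?mul1r // sqrrN expr1n. Qed.

Lemma absV x : v x^-1 = (v x)^-1.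
Proof.
have [->|x0] := eqVneq x 0; first by rewrite invr0 abs0 invr0.
have vx0 : v x != 0 by rewrite abs_eq0.
by apply: (mulfI vx0); rewrite -absM !divff ?abs1.
Qed.

Lemma abs_div x y : v (x / y) = v x / v y. Proof. by rewrite absM absV. Qed.

Lemma absB x y : v (x - y) = v (y - x). Proof. by rewrite -absN opprB. Qed.

Lemma absB_le x y : v (x - y) <= v x + v y.
Proof. by rewrite -(absN y) absD. Qed.

Lemma absD3 x y z : v (x + y + z) <= v x + v y + v z.
Proof. by rewrite (le_trans (absD _ _)) // lerD2r absD. Qed.

Lemma abs_nat_le n : v n%:R <= n%:R.
Proof.
elim: n => [|n IHn]; first by rewrite abs0.
by rewrite -natr1 (le_trans (absD _ _)) // abs1 -natr1 lerD2r.
Qed.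

Lemma abs_sum (I : Type) (s : seq I) (f : I -> F) :
  v (\sum_(i <- s) f i) <= \sum_(i <- s) v (f i).
Proof.
elim: s => [|i s IHs]; first by rewrite !big_nil abs0.
by rewrite !big_cons (le_trans (absD _ _)) // lerD2l.
Qed.

Lemma abs_geometric0 (C r : R) x : 0 <= r < 1 ->
  (forall k, v x <= C * r ^+ k) -> x = 0.
Proof.
move=> r01 H; apply/eqP; rewrite -abs_eq0; apply: contraT => vx0.
have vx_gt0 : 0 < v x by rewrite lt_def vx0 abs_ge0.
have C0 : 0 < C by have := H 0; rewrite expr0 mulr1; apply: lt_le_trans.
have [k] := expr_small r01 (divr_gt0 vx_gt0 C0).
by rewrite ltr_pdivlMr // mulrC ltNge H.
Qed.

Lemma converges_unique u x y :
  converges_for v u x -> converges_for v u y -> x = y.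
Proof.
move=> ux uy; apply/eqP; rewrite -subr_eq0 -abs_eq0; apply: contraT => n0.
have e0 : 0 < v (x - y) / 2 by rewrite divr_gt0 // lt_def n0 abs_ge0.
have [n1 P1] := ux _ e0; have [n2 P2] := uy _ e0.
have := P1 _ (leq_maxl n1 n2); have := P2 _ (leq_maxr n1 n2).
have := absD (x - u (maxn n1 n2)) (u (maxn n1 n2) - y).
rewrite (absB x) addrA subrK => A B C.
by have := le_lt_trans A (ltrD C B); rewrite -splitr ltxx.
Qed.

Lemma converges_cauchy u x : converges_for v u x -> cauchy_for v u.
Proof.
move=> ux e e0; have e2 : 0 < e / 2 by rewrite divr_gt0.
have [n nP] := ux _ e2; exists n => i j ni nj.
rewrite -(subrK x (u i)) -addrA (le_lt_trans (absD _ _)) //.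
by rewrite (absB x) (splitr e) ltrD ?nP.
Qed.

Hypothesis v_complete : complete_for v.

(** The rate of convergence survives in the limit; both the fixed point of
    Hensel's lemma and the embedding of the reals are built from it. *)
Lemma complete_geometric (D r : R) u : 0 <= r < 1 ->
  (forall k j, v (u (k + j)%N - u k) <= D * r ^+ k) ->
  exists l, forall k, v (l - u k) <= D * r ^+ k.
Proof.
move=> r01 H.
have H' n i j : (n <= i)%N -> (n <= j)%N -> v (u i - u j) <= (D * r ^+ n) * 2.
  move=> ni nj; rewrite -(subrK (u n) (u i)) -addrA (le_trans (absD _ _)) //.
  rewrite (absB (u n)) mulr_natr mulr2n.
  by rewrite lerD // -[in X in v X](subnKC ni, subnKC nj) // -(subnKC nj).
have D0 : 0 <= D.
  by have := H 0 0; rewrite expr0 mulr1; apply: le_trans; apply: abs_ge0.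
have [|l lP] := v_complete (u := u).
  move=> e e0; have D2 : 0 < D * 2 + 1 by rewrite ltr_wpDl ?mulr_ge0.
  have [n nP] := expr_small r01 (divr_gt0 e0 D2); exists n => i j ni nj.
  apply: le_lt_trans (H' _ _ _ ni nj) _; move: nP; rewrite ltr_pdivlMr //.
  apply: le_lt_trans; rewrite mulrAC [leRHS]mulrC ler_wpM2r ?lerDl //.
  by case/andP: r01 => *; apply: exprn_ge0.
exists l => k; rewrite leNgt; apply/negP; rewrite -subr_gt0 => lt0.
have [n nP] := lP _ lt0.
have := nP (k + n)%N (leq_addl _ _); rewrite ltrBrDr ltNge => /negP; apply.
rewrite -[X in v (X - _)](subrK (u (k + n)%N) l) -addrA (le_trans (absD _ _)) //.
by rewrite (absB l) lerD2l.
Qed.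

End AbsoluteValue.

Lemma comp_absolute_value (R : realType) (F E : fieldType) (v : E -> R)
    (g : {rmorphism F -> E}) : absolute_value v -> absolute_value (v \o g).
Proof.
move=> vP; split=> [x|x|x y|x y] /=; rewrite ?rmorphM ?rmorphD.
- exact: abs_ge0.
- by split=> [/eqP|->]; rewrite ?rmorph0 ?(abs0 vP) // (abs_eq0 vP) fmorph_eq0 => /eqP.
- exact: absM.
- exact: absD.
Qed.

(** * Ultrametric absolute values *)
Definition ultrametric (R : realType) (F : fieldType) (v : F -> R) :=
  forall x y, v (x + y) <= Num.max (v x) (v y).

(** Each of the [n + 1] terms of [(x + y) ^ n] is at most [max ^ n], because the
    binomial coefficients are; n-th roots remove the factor [n + 1]. *)
Lemma abs_ultrametric (R : realType) (F : fieldType) (v : F -> R) :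
  absolute_value v -> (forall n, v n%:R <= 1) -> ultrametric v.
Proof.
move=> vP vn x y; set M := Num.max _ _.
have M0 : 0 <= M by rewrite le_max (abs_ge0 vP).
apply: (@ler_of_expr_bound _ _ _ 1); rewrite ?(abs_ge0 vP) // => n.
rewrite -absX // exprDn mul1r mulrC mulr_natr.
rewrite (le_trans (abs_sum vP _ _)) //.
apply: (@le_trans _ _ (\sum_(i < n.+1) M ^+ n)); last first.
  by rewrite sumr_const card_ord.
apply: ler_sum => i _; rewrite -mulr_natr !(absM vP) !(absX vP).
have -> : M ^+ n = M ^+ (n - i) * M ^+ i.
  by rewrite -exprD subnK // -ltnS.
rewrite -[leRHS]mulr1 ler_pM ?mulr_ge0 ?exprn_ge0 ?(abs_ge0 vP) //.
rewrite ler_pM ?exprn_ge0 ?(abs_ge0 vP) //;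
by rewrite lerXn2r ?qualifE /= ?(abs_ge0 vP) // le_max lexx ?orbT.
Qed.

Section Ultrametric.
Variables (R : realType) (F : fieldType) (v : F -> R).
Hypotheses (vP : absolute_value v) (vU : ultrametric v).
Implicit Types x y z : F.

Lemma ultra_le x y (M : R) : v x <= M -> v y <= M -> v (x + y) <= M.
Proof. by move=> xM yM; rewrite (le_trans (vU _ _)) // ge_max xM. Qed.

Lemma ultra_lt x y (M : R) : v x < M -> v y < M -> v (x + y) < M.
Proof. by move=> xM yM; rewrite (le_lt_trans (vU _ _)) // gt_max xM. Qed.

Lemma ultra_nat_le n : v n%:R <= 1.
Proof.
elim: n => [|n IHn]; first by rewrite (abs0 vP).
by rewrite -natr1 ultra_le // (abs1 vP).
Qed.

Lemma ultra_add1 x : v x < 1 -> v (1 + x) = 1.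
Proof.
move=> x1; apply/eqP; rewrite eq_le; apply/andP; split.
  by apply: ultra_le; rewrite ?(abs1 vP) // ltW.
rewrite leNgt; apply/negP => x1'; have := @ultra_lt (1 + x) (- x) 1 x1'.
by rewrite (absN vP) addrK (abs1 vP) ltxx => /(_ x1).
Qed.

Hypothesis v_complete : complete_for v.

(** The right hand side contracts the closed ball of radius [v p < 1], so its
    iterates from 0 converge to a fixed point. *)
Lemma hensel_cubic p q s : v p < 1 -> v q <= 1 -> v s <= 1 ->
  exists x, x = p + q * x ^+ 2 + s * x ^+ 3.
Proof.
move=> p1 q1 s1; pose f x := p + q * x ^+ 2 + s * x ^+ 3.
pose u k := iter k f 0; set r := v p.
have r0 : 0 <= r by exact: abs_ge0.
have r01 : 0 <= r < 1 by rewrite r0.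
have le1 x y : v x <= 1 -> v y <= r -> v (x * y) <= r.
  by move=> x1 yr; rewrite (absM vP) -[leRHS]mul1r ler_pM ?(abs_ge0 vP).
have f_ball x : v x <= r -> v (f x) <= r.
  move=> xr; have x1 := le_trans xr (ltW p1).
  do !apply: ultra_le => //; apply: (le1) => //; rewrite exprS; apply: (le1) => //.
  by rewrite expr2 le1.
have u_ball k : v (u k) <= r.
  elim: k => [|k IHk]; first by rewrite (abs0 vP).
  exact: f_ball.
have f_contr x y : v x <= r -> v y <= r -> v (f x - f y) <= r * v (x - y).
  move=> xr yr.
  have -> : f x - f y = (q * (x + y) + s * (x * (x + y) + y * y)) * (x - y).
    by rewrite /f; ring.
  rewrite (absM vP) ler_wpM2r ?(abs_ge0 vP) //.
  have x1 := le_trans xr (ltW p1); have y1 := le_trans yr (ltW p1).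
  apply: ultra_le; apply: (le1) => //; apply: ultra_le => //; apply: (le1) => //.
  exact: ultra_le.
have u_step k : v (u k.+1 - u k) <= 1 * r ^+ k.
  elim: k => [|k IHk].
    by rewrite subr0 expr0 mulr1 (le_trans (u_ball 1)) // ltW.
  rewrite exprS mulrCA (le_trans (f_contr (u k.+1) (u k) _ _)) // ler_wpM2l //.
have [|l lP] := complete_geometric vP v_complete r01 (D := 1) (u := u).
  move=> k j; elim: j => [|j IHj].
    by rewrite addn0 subrr (abs0 vP) mul1r exprn_ge0.
  rewrite addnS -(subrK (u (k + j)%N) (u _.+1)) -addrA ultra_le //.
  rewrite (le_trans (u_step _)) // !mul1r exprD ler_piMr ?exprn_ge0 //.
  by rewrite exprn_ile1 // ltW.
exists l; apply/eqP; rewrite -subr_eq0; apply/eqP.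
apply: (abs_geometric0 vP (C := r + r) r01) => k.
have l_ball : v l <= r.
  rewrite -(subrK (u 1) l) ultra_le //.
  by rewrite (le_trans (lP 1)) // mul1r expr1.
rewrite -/(f l) -[X in v (X - _)](subrK (u k.+1) l) -addrA.
rewrite [leRHS]mulrDl (le_trans (absD vP _ _)) // lerD //.
  by have := lP k.+1; rewrite mul1r exprS.
rewrite (le_trans (f_contr (u k) l _ _)) // ler_wpM2l // (absB vP).
by rewrite -[leRHS]mul1r.
Qed.
End Ultrametric.

(** * Archimedean completions contain the complex numbers *)
Section RealEmbedding.
Variables (R : realType) (F : fieldType) (v : F -> R) (N : nat).
Hypotheses (vP : absolute_value v) (v_complete : complete_for v).
Hypothesis vN1 : 1 < v N%:R.

Local Notation B := (v N%:R).
Local Notation r := (v N%:R)^-1.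
Local Notation D := (N%:R / (v N%:R - 1)).

Let B0 : 0 < B. Proof. exact: lt_trans vN1. Qed.
Let B1 : 0 < B - 1. Proof. by rewrite subr_gt0. Qed.
Let D0 : 0 <= D. Proof. by rewrite divr_ge0 // ltW. Qed.
Let r01 : 0 <= r < 1.
Proof. by rewrite invr_ge0 ltW //= invf_lt1. Qed.
Let N_gt1 : (1 < N)%N.
Proof.
rewrite ltnNge; apply/negP => N1.
have := lt_le_trans vN1 (abs_nat_le vP N).
by rewrite ltNge -[1]/(1%:R) ler_nat N1.
Qed.
Let N0F : N%:R != 0 :> F.
Proof. by rewrite -(abs_gt0 vP). Qed.
Let N0R k : 0 < N%:R ^+ k :> R.
Proof. by rewrite exprn_gt0 // ltr0n ltnW. Qed.
Let N1R k : 1 <= N%:R ^+ k :> R.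
Proof. by rewrite exprn_ege1 // ler1n ltnW. Qed.

(** An integer with few base N digits is small: the digits are at most N, and
    the powers of [B] sum up to a geometric series. Subtracting 1 from [B ^ k]
    makes the induction close. *)
Lemma abs_nat_digits k m : (m < N ^ k)%N -> v m%:R <= D * B ^+ k.
Proof.
suff: (m < N ^ k)%N -> v m%:R <= D * (B ^+ k - 1).
  move=> H /H /le_trans; apply; apply: ler_wpM2l => //.
  by rewrite lerBlDr lerDl.
elim: k m => [|k IHk] m.
  by rewrite expn0 ltnS leqn0 => /eqP->; rewrite expr0 subrr mulr0 (abs0 vP).
rewrite expnSr => ltm.
have lt_q : (m %/ N < N ^ k)%N by rewrite ltn_divLR // ltnW.
rewrite (divn_eq m N) natrD natrM (le_trans (absD vP _ _)) // (absM vP).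
have q_le := IHk _ lt_q.
have r_le : v (m %% N)%:R <= N%:R.
  by rewrite (le_trans (abs_nat_le vP _)) // ler_nat ltnW // ltn_mod ltnW.
have -> : D * (B ^+ k.+1 - 1) = D * (B ^+ k - 1) * B + N%:R.
  have : B - 1 != 0 by rewrite gt_eqF.
  by rewrite exprS => ?; field.
by apply: lerD => //; apply: ler_wpM2r => //; apply: ltW.
Qed.

Lemma abs_int_digits (z : int) c k :
  `|z%:~R| < N%:R ^+ (c + k) :> R -> v z%:~R <= D * B ^+ (c + k).
Proof.
have -> : v z%:~R = v (absz z)%:R.
  by rewrite pmulrn abszE; case: (ger0P z) => _; rewrite ?rmorphN ?(absN vP).
move=> H; apply: abs_nat_digits; rewrite -(ltr_nat R) natrX.
by rewrite natr_absz intr_norm.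
Qed.

(** The truncated base N expansion. Its denominators are powers of N, whose
    absolute value is known exactly; a general rational approximation of [a]
    would need a lower bound for the absolute value of its denominator. *)
Definition nadic (a : R) k : F := (Num.floor (a * N%:R ^+ k))%:~R / N%:R ^+ k.

Let floorP (a : R) : exists2 s, 0 <= s < 1 & (Num.floor a)%:~R = a - s.
Proof.
exists (a - (Num.floor a)%:~R); last by rewrite opprB addrC subrK.
by rewrite subr_ge0 floor_le ltrBlDl (lt_le_trans (floorD1_gt a)) // intrD.
Qed.

(** Two approximations with a common denominator differ by an integer that is
    small as a real number, hence has few digits, hence is small for [v]. *)
Lemma nadic_cauchy a k j : v (nadic a (k + j) - nadic a k) <= D * r ^+ k.
Proof.
pose z : int := Num.floor (a * N%:R ^+ (k + j)) - (N ^ j)%:Z * Num.floor (a * N%:R ^+ k).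
have -> : nadic a (k + j) - nadic a k = z%:~R / N%:R ^+ (k + j).
  rewrite /nadic /z rmorphB rmorphM /= -!pmulrn natrX (exprD (N%:R : F)).
  have := expf_neq0 k N0F; have := expf_neq0 j N0F.
  move: (_ ^+ j) (_ ^+ k) => M M' M0 M'0.
  by field; rewrite M0.
have z_lt : `|z%:~R| < N%:R ^+ (0 + j) :> R.
  rewrite add0n /z rmorphB rmorphM /= -!pmulrn natrX.
  have [s /andP[s0 s1] ->] := floorP (a * N%:R ^+ (k + j)).
  have [t /andP[t0 t1] ->] := floorP (a * N%:R ^+ k).
  have := N1R j; rewrite exprD ltr_norml; set M := N%:R ^+ j; set M' := N%:R ^+ k.
  move=> M1; have : M * t < M by rewrite gtr_pMr // N0R.
  have : 0 <= M * t by rewrite mulr_ge0 // ltW // N0R.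
  by move=> ? ?; apply/andP; split; nra.
rewrite (abs_div vP) (absX vP) ler_pdivrMr ?exprn_gt0 //.
rewrite (le_trans (abs_int_digits z_lt)) // add0n exprD exprVn.
by rewrite mulrA mulfVK // expf_neq0 // gt_eqF.
Qed.

Definition real_embed (a : R) : F :=
  sval (cid (complete_geometric vP v_complete r01 (nadic_cauchy a))).

Lemma real_embedP a k : v (real_embed a - nadic a k) <= D * r ^+ k.
Proof. by rewrite /real_embed; case: cid => l lP /=. Qed.

Lemma real_embed_unique a x C :
  (forall k, v (x - nadic a k) <= C * r ^+ k) -> x = real_embed a.
Proof.
move=> xP; apply/eqP; rewrite -subr_eq0; apply/eqP.
apply: (abs_geometric0 vP (C := C + D) r01) => k.
rewrite -(subrK (nadic a k) x) -addrA mulrDl (le_trans (absD vP _ _)) // lerD //.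
by rewrite (absB vP) real_embedP.
Qed.

Lemma real_embed_zmod_morphism : zmod_morphism real_embed.
Proof.
move=> a b; apply/esym/(@real_embed_unique _ _ (D + D + D * B)) => k.
set x := real_embed a; set y := real_embed b.
have -> : x - y - nadic (a - b) k
  = (x - nadic a k) - (y - nadic b k) + (nadic a k - nadic b k - nadic (a - b) k).
  by ring.
rewrite (le_trans (absD vP _ _)) // [leRHS]mulrDl lerD //.
  by rewrite mulrDl (le_trans (absB_le vP _ _)) // lerD // real_embedP.
rewrite /nadic -!mulrBl -!rmorphB; set z : int := _ - _ - _.
have z_lt : `|z%:~R| < N%:R ^+ (1 + 0) :> R.
  rewrite /z !rmorphB /=.
  have [s /andP[s0 s1] ->] := floorP (a * N%:R ^+ k).
  have [t /andP[t0 t1] ->] := floorP (b * N%:R ^+ k).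
  have [u /andP[u0 u1] ->] := floorP ((a - b) * N%:R ^+ k).
  have : 2 <= N%:R :> R by rewrite (ler_nat _ 2).
  by rewrite addn0 expr1 ltr_norml mulrBl => ?; apply/andP; split; lra.
rewrite (abs_div vP) (absX vP) exprVn ler_wpM2r ?invr_ge0 ?exprn_ge0 ?(abs_ge0 vP) //.
by have := abs_int_digits z_lt; rewrite addn0 expr1.
Qed.

Lemma nadicM a b : exists C, forall k,
  v (nadic a k * nadic b k - nadic (a * b) k) <= C * r ^+ k.
Proof.
have [c cP] := @expr_unbounded _ N%:R (`|a| + `|b| + 2)
  (etrans (ltr_nat _ 1 _) N_gt1).
exists (D * B ^+ c) => k.
pose z : int := Num.floor (a * N%:R ^+ k) * Num.floor (b * N%:R ^+ k)
  - (N ^ k)%:Z * Num.floor (a * b * N%:R ^+ k).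
have -> : nadic a k * nadic b k - nadic (a * b) k = z%:~R / N%:R ^+ (k + k).
  rewrite /nadic /z rmorphB !rmorphM /= -!pmulrn natrX exprD.
  by have := expf_neq0 k N0F => ?; field.
have z_lt : `|z%:~R| < N%:R ^+ (c + k) :> R.
  rewrite /z rmorphB !rmorphM /= -!pmulrn natrX.
  have [s /andP[s0 s1] ->] := floorP (a * N%:R ^+ k).
  have [t /andP[t0 t1] ->] := floorP (b * N%:R ^+ k).
  have [u /andP[u0 u1] ->] := floorP (a * b * N%:R ^+ k).
  rewrite exprD; have := N1R k; move: cP; move: (N%:R ^+ c) (N%:R ^+ k) => Q M QP M1.
  have M0 : 0 < M by apply: lt_le_trans M1.
  have -> : (a * M - s) * (b * M - t) - M * (a * b * M - u)
    = s * t + (u - s * b - t * a) * M by ring.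
  have st : `|s * t| <= M.
    by rewrite ger0_norm ?mulr_ge0 //; apply: le_trans M1; rewrite mulr_ile1 // ltW.
  have sb (q x : R) : 0 <= q -> q < 1 -> `|q * x| <= `|x|.
    by move=> q0 q1; rewrite normrM (ger0_norm q0) ler_piMl // ltW.
  have ub : `|u - s * b - t * a| <= 1 + `|b| + `|a|.
    rewrite (le_trans (ler_normB _ _)) // lerD ?sb //.
    by rewrite (le_trans (ler_normB _ _)) // lerD ?sb // ger0_norm // ltW.
  apply: le_lt_trans (ler_normD _ _) _; rewrite [`|_ * M|]normrM (gtr0_norm M0).
  have : `|u - s * b - t * a| * M <= (1 + `|b| + `|a|) * M by rewrite ler_pM2r.
  have : (`|a| + `|b| + 2) * M < Q * M by rewrite ltr_pM2r.
  nra.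
rewrite (abs_div vP) (absX vP) ler_pdivrMr ?exprn_gt0 //.
rewrite (le_trans (abs_int_digits z_lt)) // !exprD exprVn.
have := expf_neq0 k (lt0r_neq0 B0).
by move=> ?; rewrite [leRHS]mulrA mulfVK // mulrA.
Qed.

Lemma real_embed_monoid_morphism : monoid_morphism real_embed.
Proof.
split.
  apply/esym/(@real_embed_unique _ _ 0) => k.
  have N0k := expf_neq0 k N0F.
  rewrite /nadic mul1r -natrX.
  have -> : Num.floor ((N ^ k)%:R : R) = (N ^ k)%:Z by rewrite pmulrn intrKfloor.
  by rewrite -pmulrn natrX divff // subrr (abs0 vP) mul0r.
move=> a b; have [C CP] := nadicM a b; set x := real_embed a; set y := real_embed b.
apply/esym/(@real_embed_unique _ _ (v x * D + D * (v y + D) + C)) => k.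
have -> : x * y - nadic (a * b) k = x * (y - nadic b k)
  + (x - nadic a k) * nadic b k + (nadic a k * nadic b k - nadic (a * b) k).
  by ring.
have yk := real_embedP b k; have xk := real_embedP a k.
have rk : 0 <= r ^+ k by rewrite exprn_ge0 //; case/andP: r01.
rewrite (le_trans (absD3 vP _ _ _)) //.
rewrite [leRHS]mulrDl [X in _ <= X + _]mulrDl (absM vP x) (absM vP (x - _)).
apply: lerD (CP k); apply: lerD.
  by rewrite -mulrA ler_wpM2l ?(abs_ge0 vP).
rewrite [leRHS]mulrAC ler_pM ?(abs_ge0 vP) //.
rewrite -(subrK y (nadic b k)) addrC (le_trans (absD vP _ _)) // lerD2l.
have rk1 : r ^+ k <= 1 by case/andP: r01 => r0 /ltW r1; rewrite exprn_ile1.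
by rewrite (absB vP) (le_trans yk) // ler_piMr.
Qed.

HB.instance Definition _ := GRing.isZmodMorphism.Build R F real_embed
  real_embed_zmod_morphism.
HB.instance Definition _ := GRing.isMonoidMorphism.Build R F real_embed
  real_embed_monoid_morphism.

End RealEmbedding.

Section ComplexEmbedding.
Variables (R : realType) (F : fieldType) (f : {rmorphism R -> F}) (j : F).
Hypothesis j2 : j ^+ 2 = -1.

Definition complex_embed (z : R[i]) : F := f (complex.Re z) + f (complex.Im z) * j.

Lemma complex_embed_zmod_morphism : zmod_morphism complex_embed.
Proof.
by case=> a b [c d]; rewrite /complex_embed /= !rmorphB /=; ring.
Qed.

Lemma complex_embed_monoid_morphism : monoid_morphism complex_embed.
Proof.
split; first by rewrite /complex_embed /= rmorph1 rmorph0 mul0r addr0.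
case=> a b [c d]; rewrite /complex_embed /=.
by rewrite rmorphB rmorphD !rmorphM /=; ring: j2.
Qed.

HB.instance Definition _ := GRing.isZmodMorphism.Build R[i] F complex_embed
  complex_embed_zmod_morphism.
HB.instance Definition _ := GRing.isMonoidMorphism.Build R[i] F complex_embed
  complex_embed_monoid_morphism.

End ComplexEmbedding.

(** An algebraic number is a root of a rational polynomial, which already splits
    in [C]: its image in [F] comes from [C], where cube roots exist. *)
Lemma cube_root_of_closed (C : closedFieldType) (F : fieldType)
    (f : {rmorphism C -> F}) (g : {rmorphism rat -> C}) (K : fieldExtType rat)
    (h : {rmorphism K -> F}) (a : K) : exists c, c ^+ 3 = h a.
Proof.
have [z zP] : exists z, f z = h a.
  have [p] : exists2 p : {poly rat}, p != 0 & root (map_poly (in_alg K) p) a.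
    have /polyOver1P[p pP] := minPolyOver 1%AS a.
    exists p; last by rewrite -pP root_minPoly.
    apply: contraTneq (monic_minPoly 1%AS a) => p0.
    by rewrite pP p0 rmorph0 monicE lead_coef0 eq_sym oner_eq0.
  move=> p0 /(rmorph_root h); rewrite -map_poly_comp /=.
  have -> : map_poly (h \o in_alg K) p = map_poly f (map_poly g p).
    rewrite -map_poly_comp; apply: eq_map_poly => q.
    by rewrite (fmorph_eq_rat (h \o in_alg K)%FUN) (fmorph_eq_rat (f \o g)%FUN).
  have [s ->] := closed_field_poly_normal (map_poly g p).
  rewrite map_polyZ rootZ ?fmorph_eq0 ?lead_coef_eq0 ?map_poly_eq0 //.
  rewrite rmorph_prod /= (eq_bigr (fun z => 'X - (f z)%:P)); last first.
    by move=> z _; rewrite rmorphB /= map_polyX map_polyC.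
  rewrite -(big_map f predT (fun z => 'X - z%:P)) root_prod_XsubC.
  by case/mapP => z _ ->; exists z.
have /closed_rootP[w /eqP] : size ('X^3 - z%:P) != 1 by rewrite size_XnsubC.
rewrite !hornerE => /eqP; rewrite subr_eq0 => /eqP wz.
by exists (f w); rewrite -rmorphXn wz zP.
Qed.

Lemma prim3_sqr (F : fieldType) (eps : F) : 3.-primitive_root eps ->
  eps ^+ 2 = - 1 - eps.
Proof.
move=> prim; apply/eqP; rewrite -subr_eq0; apply/eqP.
have e1 : eps - 1 != 0.
  by rewrite subr_eq0 -[eps]expr1 -(prim_order_dvd prim).
apply: (mulfI e1); rewrite mulr0.
have e3 := prim_expr_order prim.
by ring: e3.
Qed.

Lemma archimedean_cube_root (R : realType) (F : fieldType) (v : F -> R)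
    (K : fieldExtType rat) (h : {rmorphism K -> F}) (eps : F) N :
  absolute_value v -> complete_for v -> 1 < v N%:R -> 3.-primitive_root eps ->
  forall a, exists c, c ^+ 3 = h a.
Proof.
move=> vP vC vN prim a.
pose f : {rmorphism R -> F} := real_embed vP vC vN.
pose s := f (Num.sqrt 3).
have s2 : s ^+ 2 = 3%:R by rewrite -rmorphXn sqr_sqrtr //= rmorph_nat.
have s0 : s != 0.
  by rewrite fmorph_eq0 sqrtr_eq0 -ltNge.
have e := prim3_sqr prim.
(* [2 eps + 1] is a square root of -3 *)
have j2 : ((2%:R * eps + 1) / s) ^+ 2 = -1.
  rewrite exprMn exprVn s2.
  have -> : (2%:R * eps + 1) ^+ 2 = - 3%:R by ring: e.
  by rewrite mulNr divff // -s2 expf_neq0.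
exact: (@cube_root_of_closed R[i] F (complex_embed f ((2%:R * eps + 1) / s))
  (ratr : rat -> R[i]) K h a).
Qed.

(** * The norm form and zero divisors of symbol algebras *)
Lemma twisted_factor (A : nzRingType) (y m m1 m2 : A) :
  y * m2 = m * y -> y * m1 = m2 * y -> m * m2 = m2 * m ->
  m * (m1 * m2) = y ^+ 3 -> (y - m) * (y ^+ 2 + m2 * y + m1 * m2) = 0.
Proof.
move=> ym2 ym1 mm2 Nm; rewrite mulrBl !mulrDr Nm -exprS.
rewrite [y * (m2 * y)]mulrA ym2 [y * (m1 * m2)]mulrA ym1 -[m2 * y * m2]mulrA ym2.
rewrite [m2 * (m * y)]mulrA -mm2 -[m * y * y]mulrA -expr2 -[m * m2 * y]mulrA.
by apply/eqP; rewrite subr_eq0 -addrA addrC.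
Qed.

Section NormForm.
Variables (F : fieldType) (a : F).

(** The norm of [c0 + c1 t + c2 t^2] for [t^3 = a]. *)
Definition nform (c0 c1 c2 : F) : F :=
  c0 ^+ 3 + a * c1 ^+ 3 + a ^+ 2 * c2 ^+ 3 - 3%:R * a * c0 * c1 * c2.

(** Call [(c0^2 - a c1 c2, a c2^2 - c0 c1, c1^2 - c0 c2)] the adjugate of
    [(c0, c1, c2)]. The adjugate of an element of norm 0 has adjugate 0. An element
    [(d0, d1, d2)] with adjugate 0 satisfies [d1^3 = a d2^3], so it is 0 if [a] is
    not a cube; this is used twice. *)
Lemma nform_anisotropic c0 c1 c2 : (forall c, c ^+ 3 != a) ->
  nform c0 c1 c2 = 0 -> [/\ c0 = 0, c1 = 0 & c2 = 0].
Proof.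
move=> noncube nform0.
have deg (d0 d1 d2 : F) : d1 ^+ 2 = d0 * d2 -> d0 * d1 = a * d2 ^+ 2 ->
    d0 ^+ 2 = a * d1 * d2 -> [/\ d0 = 0, d1 = 0 & d2 = 0].
  have [->|d2_neq0] := eqVneq d2 0.
    rewrite !mulr0 => /eqP; rewrite sqrf_eq0 => /eqP-> _ /eqP.
    by rewrite sqrf_eq0 => /eqP->.
  move=> e1 e2 _; case/eqP: (noncube (d1 / d2)).
  rewrite expr_div_n; apply: (canLR (mulfK (expf_neq0 3 d2_neq0))).
  by rewrite exprS e1 mulrA [d1 * _]mulrC e2 -mulrA -exprSr.
have [] := deg (c0 ^+ 2 - a * c1 * c2) (a * c2 ^+ 2 - c0 * c1) (c1 ^+ 2 - c0 * c2).
- apply/eqP; rewrite -subr_eq0; apply/eqP.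
  by rewrite -[RHS](mulr0 c2) -nform0 /nform; ring.
- by apply/eqP; rewrite -subr_eq0; apply/eqP;
     rewrite -[RHS](mulr0 (- c1)) -nform0 /nform; ring.
- by apply/eqP; rewrite -subr_eq0; apply/eqP;
     rewrite -[RHS](mulr0 c0) -nform0 /nform; ring.
by move=> /subr0_eq e0 /subr0_eq e1 /subr0_eq e2; apply: deg.
Qed.

End NormForm.

Section SymbolAlgebraNorm.
Variables (F : fieldType) (a b eps : F).
Hypothesis prim : 3.-primitive_root eps.
Local Notation A := (symbol_algebra a b prim).
Local Notation x := (symbol_x a b prim).
Local Notation y := (symbol_y a b prim).
Local Notation P := (horner_alg (x : A)).
Implicit Types p q : {poly F}.

Let eps3 : eps ^+ 3 = 1. Proof. exact: prim_expr_order. Qed.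

Definition trinom (c0 c1 c2 : F) : {poly F} := c0%:P + c1%:P * 'X + c2%:P * 'X^2.

Let PX3 : P 'X^3 = a%:A.
Proof. by rewrite rmorphXn /= horner_algX symbol_x3. Qed.

Let PC c : P c%:P = c%:A. Proof. exact: horner_algC. Qed.

Let PC_mul c p : P (c%:P * p) = c *: P p.
Proof. by rewrite rmorphM /= PC -scalerAl mul1r. Qed.

(** Reduction modulo [X^3 - a]. *)
Lemma symbol_trinom p : exists c0 c1 c2, P p = P (trinom c0 c1 c2).
Proof.
elim/poly_ind: p => [|p c [c0 [c1 [c2 IHp]]]].
  by exists 0, 0, 0; rewrite /trinom !mul0r !addr0.
exists (a * c2 + c), c0, c1.
rewrite rmorphD rmorphM /= IHp -rmorphM -rmorphD.
have -> : trinom c0 c1 c2 * 'X + c%:P = trinom c c0 c1 + c2%:P * 'X^3.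
  by rewrite /trinom; ring.
have -> : trinom (a * c2 + c) c0 c1 = trinom c c0 c1 + c2%:P * a%:P.
  by rewrite /trinom polyCD polyCM; ring.
by rewrite !rmorphD /= !PC_mul PX3 !PC.
Qed.

(** Conjugation by [y] is the automorphism [x -> eps x] of [F[x]]. *)
Lemma symbol_y_comm p : y * P p = P (p \Po (eps%:P * 'X)) * y.
Proof.
elim/poly_ind: p => [|p c IHp]; first by rewrite comp_poly0 !rmorph0 mulr0 mul0r.
rewrite comp_polyD comp_polyM comp_polyX comp_polyC !rmorphD !rmorphM /=.
rewrite !PC horner_algX mulrDr mulrDl [y * (_ * x)]mulrA IHp -!mulrA symbol_yx.
by rewrite -!scalerAl -!scalerAr !mul1r mulr1.
Qed.

Let conjE c0 c1 c2 : trinom c0 c1 c2 \Po (eps%:P * 'X)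
  = trinom c0 (eps * c1) (eps ^+ 2 * c2).
Proof.
rewrite /trinom ['X^2]expr2 !(comp_polyD, comp_polyM) !comp_polyC !comp_polyX.
by rewrite !polyCM; ring.
Qed.

Lemma symbol_y_trinom c0 c1 c2 :
  y * P (trinom c0 c1 c2) = P (trinom c0 (eps * c1) (eps ^+ 2 * c2)) * y.
Proof. by rewrite symbol_y_comm conjE. Qed.

(** The three factors are the conjugates of the first one, so the cubic form
    [nform] is the norm. *)
Lemma symbol_trinom_norm c0 c1 c2 :
  P (trinom c0 c1 c2 * trinom c0 (eps * c1) (eps ^+ 2 * c2)
     * trinom c0 (eps ^+ 2 * c1) (eps * c2)) = (nform a c0 c1 c2)%:A.
Proof.
have e2 := prim3_sqr prim.
have E2 : eps%:P ^+ 2 = -1 - eps%:P :> {poly F} by rewrite -polyC_exp e2 polyCB polyCN.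
pose e := c1 ^+ 3 - 3%:R * c0 * c1 * c2.
have -> : trinom c0 c1 c2 * trinom c0 (eps * c1) (eps ^+ 2 * c2)
     * trinom c0 (eps ^+ 2 * c1) (eps * c2)
  = (c0 ^+ 3)%:P + e%:P * 'X^3 + (c2 ^+ 3)%:P * ('X^3 * 'X^3).
  rewrite /trinom /e !(polyCM, polyCB, polyCN, polyC_exp, polyCMn) polyC1.
  by ring: E2.
rewrite 2!rmorphD /= !PC_mul (rmorphM P 'X^3) /= PX3 !PC -scalerAl mul1r !scalerA -!scalerDl.
by congr (_ *: _); rewrite /nform /e; ring.
Qed.

(** The left factor is the product of the two other conjugates; it inverts any
    element of nonzero norm. *)
Lemma symbol_trinom_adj c0 c1 c2 :
  P (trinom (c0 ^+ 2 - a * c1 * c2) (a * c2 ^+ 2 - c0 * c1) (c1 ^+ 2 - c0 * c2))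
    * P (trinom c0 c1 c2) = (nform a c0 c1 c2)%:A.
Proof.
rewrite -rmorphM.
set d0 := c0 ^+ 2 - _; set d1 := _ - c0 * c1; set d2 := c1 ^+ 2 - _.
have -> : trinom d0 d1 d2 * trinom c0 c1 c2
  = (d0 * c0)%:P + (d0 * c1 + d1 * c0)%:P * 'X
    + (d0 * c2 + d1 * c1 + d2 * c0)%:P * 'X^2
    + (d1 * c2 + d2 * c1)%:P * 'X^3 + (d2 * c2)%:P * ('X^3 * 'X).
  by rewrite /trinom !(polyCM, polyCD); ring.
rewrite 4!rmorphD /= !PC_mul (rmorphM P 'X^3) /= PX3 horner_algX !PC -scalerAl mul1r.
have -> : d0 * c2 + d1 * c1 + d2 * c0 = 0 by rewrite /d0 /d1 /d2; ring.
rewrite scale0r addr0 !scalerA -addrA addrACA -!scalerDl.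
have -> : d0 * c1 + d1 * c0 + d2 * c2 * a = 0 by rewrite /d0 /d1 /d2; ring.
by rewrite scale0r addr0; congr (_ *: _); rewrite /nform /d0 /d1 /d2; ring.
Qed.

Lemma symbol_trinomE c0 c1 c2 k : P (trinom c0 c1 c2) * y ^+ k
  = c0 *: (x ^+ 0 * y ^+ k) + c1 *: (x ^+ 1 * y ^+ k) + c2 *: (x ^+ 2 * y ^+ k).
Proof.
rewrite /trinom 2!rmorphD /= !PC_mul PC rmorphXn /= horner_algX.
by rewrite expr0 expr1 !mulrDl -!scalerAl.
Qed.

Let entryD (u w : A) ij : symbol_entry (u + w) ij = symbol_entry u ij + symbol_entry w ij.
Proof. by rewrite /symbol_entry linearD mxE. Qed.

Let entryZ k (u : A) ij : symbol_entry (k *: u) ij = k * symbol_entry u ij.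
Proof. by rewrite /symbol_entry linearZ mxE. Qed.

Let entry0 ij : symbol_entry (0 : A) ij = 0.
Proof. by rewrite /symbol_entry linear0 mxE. Qed.

Lemma symbol_entry_trinom c0 c1 c2 (i k : 'I_3) j : (j < 3)%N ->
  symbol_entry (P (trinom c0 c1 c2) * y ^+ j) (i, k)
  = (k == j :> nat)%:R * [:: c0; c1; c2]`_i.
Proof.
move=> ltj; rewrite symbol_trinomE !entryD !entryZ.
have E l (ltl : (l < 3)%N) : symbol_entry (x ^+ l * y ^+ j) (i, k)
    = (i == l :> nat)%:R * (k == j :> nat)%:R.
  rewrite -(symbol_basis_xy a b prim (Ordinal ltl, Ordinal ltj)) symbol_entry_basis.
  by rewrite -pair_eqE /pair_eq /= -mulnb natrM.
rewrite !E //.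
by case: i {E} => [[|[|[|?]]]] //= ?; ring.
Qed.

Let P_entry p (i k : 'I_3) j : (j < 3)%N -> k != j :> nat ->
  symbol_entry (P p * y ^+ j) (i, k) = 0.
Proof.
move=> ltj kj; have [c0 [c1 [c2 ->]]] := symbol_trinom p.
by rewrite symbol_entry_trinom // (negPf kj) mul0r.
Qed.

Let y_entry j (ltj : (j < 3)%N) : symbol_entry (y ^+ j) (0, Ordinal ltj) = 1.
Proof.
have -> : y ^+ j = P (trinom 1 0 0) * y ^+ j.
  by rewrite /trinom !mul0r !addr0 rmorph1 mul1r.
by rewrite symbol_entry_trinom //= eqxx mul1r.
Qed.

Let P_inj0 c0 c1 c2 : P (trinom c0 c1 c2) = 0 -> [/\ c0 = 0, c1 = 0 & c2 = 0].
Proof.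
move=> P0.
have E (i : 'I_3) : [:: c0; c1; c2]`_i = 0.
  have := symbol_entry_trinom c0 c1 c2 i 0 (isT : (0 < 3)%N).
  by rewrite P0 mul0r eqxx mul1r entry0 => /esym.
split; [exact: (E (Ordinal (isT : (0 < 3)%N))) | exact: (E (Ordinal (isT : (1 < 3)%N)))
       | exact: (E (Ordinal (isT : (2 < 3)%N)))].
Qed.

Let zero_divisor (u w : A) : u != 0 -> w != 0 -> u * w = 0 -> ~ division_algebra A.
Proof.
move=> u0 w0 uw0 /(_ u u0)[z [_ zu]].
by case/eqP: w0; rewrite -[w]mul1r -zu -mulrA uw0 mulr0.
Qed.

(** [b = N(m)] makes [y - m] a zero divisor: [y^2 + m'' y + m' m''] is a
    complementary factor of [y^3 - N(m)], primes denoting the conjugates of [m]. *)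
Lemma symbol_norm_not_division c0 c1 c2 :
  b = nform a c0 c1 c2 -> ~ division_algebra A.
Proof.
move=> bE; pose q := trinom c0 c1 c2.
pose q1 := trinom c0 (eps * c1) (eps ^+ 2 * c2).
pose q2 := trinom c0 (eps ^+ 2 * c1) (eps * c2).
apply: (@zero_divisor (y - P q) (y ^+ 2 + P q2 * y + P (q1 * q2))).
- apply/eqP => /(congr1 (fun u : A => symbol_entry u (0, Ordinal (isT : (1 < 3)%N)))).
  rewrite entryD -scaleN1r entryZ -[P q]mulr1 -(expr0 y) P_entry // -[y]expr1.
  by rewrite y_entry entry0 mulr0 addr0 => /eqP; rewrite oner_eq0.
- apply/eqP => /(congr1 (fun u : A => symbol_entry u (0, Ordinal (isT : (2 < 3)%N)))).
  rewrite 2!entryD -[P (_ * _)]mulr1 -(expr0 y) P_entry // -[P q2 * _]/(P q2 * y ^+ 1).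
  by rewrite P_entry // y_entry entry0 !addr0 => /eqP; rewrite oner_eq0.
rewrite (rmorphM P q1); apply: twisted_factor.
- rewrite symbol_y_trinom; have -> : eps * (eps ^+ 2 * c1) = c1.
    by rewrite mulrA -exprS eps3 mul1r.
  by have -> : eps ^+ 2 * (eps * c2) = c2 by rewrite mulrA -exprSr eps3 mul1r.
- rewrite symbol_y_trinom; have -> : eps * (eps * c1) = eps ^+ 2 * c1.
    by rewrite mulrA -expr2.
  have -> // : eps ^+ 2 * (eps ^+ 2 * c2) = eps * c2.
  by rewrite mulrA -exprD -(prim_expr_mod prim).
- by rewrite -!rmorphM mulrC.
rewrite symbol_y3; transitivity ((nform a c0 c1 c2)%:A : A).
  by rewrite -symbol_trinom_norm !rmorphM /= mulrA.
by congr (_ *: _).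
Qed.

Lemma symbol_cube_not_division c : c ^+ 3 = a -> ~ division_algebra A.
Proof.
move=> ca; apply: (@zero_divisor (P (trinom (- c) 1 0)) (P (trinom (c ^+ 2) c 1))).
- by apply/eqP => /P_inj0[_ /eqP]; rewrite oner_eq0.
- by apply/eqP => /P_inj0[_ _ /eqP]; rewrite oner_eq0.
rewrite -rmorphM /=; have -> : trinom (- c) 1 0 * trinom (c ^+ 2) c 1 = 'X^3 - a%:P.
  by rewrite /trinom -ca !polyC_exp polyCN; ring.
by rewrite rmorphB /= PX3 PC subrr.
Qed.

End SymbolAlgebraNorm.

(** * Non-division symbol algebras *)
Section SymbolAlgebraSplit.
Variables (F : fieldType) (a b eps : F).
Hypothesis prim : 3.-primitive_root eps.
Hypothesis noncube : forall c, c ^+ 3 != a.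
Local Notation A := (symbol_algebra a b prim).
Local Notation x := (symbol_x a b prim : A).
Local Notation y := (symbol_y a b prim : A).
Local Notation P := (horner_alg x).

Lemma symbol_trinom_regular c0 c1 c2 (w : A) : w != 0 ->
  P (trinom c0 c1 c2) * w = 0 -> [/\ c0 = 0, c1 = 0 & c2 = 0].
Proof.
move=> w0 /(congr1 (fun u => P (trinom (c0 ^+ 2 - a * c1 * c2)
  (a * c2 ^+ 2 - c0 * c1) (c1 ^+ 2 - c0 * c2)) * u)) /eqP.
rewrite mulr0 mulrA symbol_trinom_adj -scalerAl mul1r scaler_eq0 (negPf w0) orbF.
by move=> /eqP; apply: nform_anisotropic.
Qed.

(** For [V] of dimension less than 6, the subspaces [F(x) w] and [F(x) y w]
    meet, so that the line [F(x) w] is stable under [y]. *)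
Lemma symbol_small_left_ideal (V : {vspace A}) (w : A) :
  w != 0 -> w \in V -> (forall u z : A, z \in V -> u * z \in V) -> (\dim V < 6)%N ->
  exists c0 c1 c2, y * w = P (trinom c0 c1 c2) * w.
Proof.
move=> w0 wV idealV ltV6.
pose X : 6.-tuple A := [tuple w; x * w; x ^+ 2 * w; y * w; x * (y * w); x ^+ 2 * (y * w)].
have : ~~ free X.
  apply/negP; rewrite /free size_tuple => /eqP dimX.
  suff: (\dim <<X>> <= \dim V)%N by rewrite dimX leqNgt ltV6.
  rewrite dimvS //; apply/span_subvP => u.
  by rewrite !inE => /or4P[/eqP->|/eqP->|/eqP->|/or3P[] /eqP->]; do ?apply: (idealV).
move/freeP/existsNP => [k /not_implyP[]].
rewrite !big_ord_recl big_ord0 /=.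
set k0 := k _; set k1 := k _; set k2 := k _; set k3 := k _; set k4 := k _; set k5 := k _.
move=> sum0 k_neq0.
have PE c0 c1 c2 (u : A) : P (trinom c0 c1 c2) * u
    = c0 *: u + (c1 *: (x * u) + c2 *: (x ^+ 2 * u)).
  have := symbol_trinomE a b prim c0 c1 c2 0; rewrite !expr0 !mulr1 expr1 => ->.
  by rewrite !mulrDl -!scalerAl mul1r addrA.
have {sum0} sum0 : P (trinom k0 k1 k2) * w + P (trinom k3 k4 k5) * (y * w) = 0.
  by rewrite !PE -[RHS]sum0 addr0 -!addrA.
set n := nform a k3 k4 k5; have n_neq0 : n != 0.
  apply/eqP => /(nform_anisotropic noncube)[e3 e4 e5]; apply: k_neq0.
  have P0 : P (trinom 0 0 0) = 0 by rewrite /trinom !mul0r !addr0 rmorph0.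
  move: sum0; rewrite e3 e4 e5 P0 mul0r addr0 => /(symbol_trinom_regular w0)[e0 e1 e2].
  case=> [[|[|[|[|[|[|?]]]]]]] //= lti;
    [rewrite -[RHS]e0 | rewrite -[RHS]e1 | rewrite -[RHS]e2 | rewrite -[RHS]e3
    | rewrite -[RHS]e4 | rewrite -[RHS]e5]; congr k; exact: val_inj.
pose d := trinom (k3 ^+ 2 - a * k4 * k5) (a * k5 ^+ 2 - k3 * k4) (k4 ^+ 2 - k3 * k5).
have [c0 [c1 [c2 cE]]] := symbol_trinom a b prim ((- n^-1)%:P * (d * trinom k0 k1 k2)).
exists c0, c1, c2; rewrite -cE.
have -> : y * w = n^-1 *: (P d * (P (trinom k3 k4 k5) * (y * w))).
  rewrite [X in _ *: X]mulrA symbol_trinom_adj -scalerAl mul1r scalerA mulVf //.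
  by rewrite scale1r.
move/eqP: sum0; rewrite addrC addr_eq0 => /eqP ->.
by rewrite !rmorphM /= horner_algC -!scalerAl mul1r mulrN scalerN scaleNr mulrA.
Qed.

(** With [y w = m w], moving [y] past [m] and its conjugates turns [y^3 w = b w]
    into the product of the three conjugates of [m], applied to [w]. *)
Lemma symbol_stable_line (w : A) c0 c1 c2 : w != 0 ->
  y * w = P (trinom c0 c1 c2) * w -> b = nform a c0 c1 c2.
Proof.
move=> w0 yw; have y3w : y ^+ 3 * w = b *: w by rewrite symbol_y3 -scalerAl mul1r.
apply/eqP; rewrite -subr_eq0; have := scaler_eq0 (b - nform a c0 c1 c2) w.
rewrite (negPf w0) orbF => <-; rewrite scalerBl subr_eq0 -y3w !exprS expr0 mulr1.
rewrite -!mulrA yw [y * (P _ * w)]mulrA symbol_y_trinom -mulrA yw.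
rewrite [y * _]mulrA symbol_y_trinom -[_ * y * _]mulrA.
rewrite [y * _]mulrA symbol_y_trinom -[_ * y * _]mulrA yw.
have -> : eps * (eps * c1) = eps ^+ 2 * c1 by rewrite mulrA -expr2.
have -> : eps ^+ 2 * (eps ^+ 2 * c2) = eps * c2.
  by rewrite mulrA -exprD -(prim_expr_mod prim).
rewrite !mulrA -!rmorphM /=.
have -> : (nform a c0 c1 c2) *: w = (nform a c0 c1 c2)%:A * w.
  by rewrite -scalerAl mul1r.
rewrite -symbol_trinom_norm; apply/eqP; congr (P _ * w); ring.
Qed.

(** A non-invertible [u] gives two left ideals, [A u] and the left annihilator
    of [u]; their dimensions add up to 9, hence one of them is less than 6. *)
Lemma symbol_not_division_norm : ~ division_algebra A ->
  exists c0 c1 c2, b = nform a c0 c1 c2.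
Proof.
move=> /existsNP[u /not_implyP[u0 Nu]].
suff [V [w [w0 wV idealV ltV6]]] : exists (V : {vspace A}) (w : A),
    [/\ w != 0, w \in V, forall u z : A, z \in V -> u * z \in V & (\dim V < 6)%N].
  have [c0 [c1 [c2 yw]]] := symbol_small_left_ideal w0 wV idealV ltV6.
  by exists c0, c1, c2; apply: symbol_stable_line yw.
have dimE := limg_ker_dim (amulr u) fullv.
rewrite capfv dim_symbol_algebra in dimE.
have [ker0|] := eqVneq (lker (amulr u)) 0%VS.
  case: Nu; move: dimE; rewrite ker0 dimv0 add0n => dimE.
  have /memv_imgP[z _] : (1 : A) \in (amulr u @: fullv)%VS.
    suff /eqP -> : (amulr u @: fullv)%VS == fullv by rewrite memvf.
    by rewrite eqEdim subvf dim_symbol_algebra dimE.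
  rewrite lfunE /= => zu; exists z; split=> //.
  have/lker0P inj : lker (amulr u) == 0%VS by rewrite ker0.
  by apply: inj; rewrite !lfunE /= mul1r -mulrA -zu mulr1.
rewrite -vpick0 => k0.
have [lt6|ge6] := ltnP (\dim (lker (amulr u))) 6.
  exists (lker (amulr u)), (vpick (lker (amulr u))); split=> //.
    exact: memv_pick.
  by move=> t z; rewrite !memv_ker !lfunE /= -mulrA => /eqP->; rewrite mulr0.
exists (amulr u @: fullv)%VS, u; split=> //.
- by apply/memv_imgP; exists 1; rewrite ?memvf // lfunE /= mul1r.
- move=> t z /memv_imgP[z' _ ->]; apply/memv_imgP; exists (t * z'); rewrite ?memvf //.
  by rewrite !lfunE /= mulrA.
rewrite -(ltn_add2l (\dim (lker (amulr u)))) dimE.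
exact: leq_trans (leq_add ge6 (leqnn 6)).
Qed.

End SymbolAlgebraSplit.

(** * The norm of a pure cubic extension *)
Import passmx.

Section FieldNorm.
Variables (F : fieldType) (E : fieldExtType F).

Lemma field_normM : {morph (@field_norm F E) : x y / x * y}.
Proof.
move=> x y; rewrite /field_norm.
have -> : amull (x * y) = (amull x \o amull y)%VF.
  by apply/lfunP => z; rewrite comp_lfunE !lfunE /= mulrA.
by rewrite (mxof_comp _ _ (vbasisP {:E})) det_mulmx mulrC.
Qed.

Lemma field_norm_scalar k : field_norm (k%:A : E) = k ^+ \dim {:E}.
Proof.
rewrite /field_norm -det_scalar; congr (\det _).
apply/matrixP => i j; rewrite !mxE /= vecof_delta lfunE /= -scalerAl mul1r.
by rewrite linearZ /= coord_free ?(basis_free (vbasisP _)) // mulr_natr eq_sym.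
Qed.

End FieldNorm.

(** The equality of dimensions is kept propositional because [\dim {:E}] does not
    compute to 3. *)
Lemma det_conjugate (F : fieldType) m n (M : 'M[F]_m) (C : 'M[F]_n) (Q : 'M[F]_(n, m)) :
  n = m -> row_free Q -> Q *m M = C *m Q -> \det M = \det C.
Proof.
move=> nm; case: m / nm M Q => M Q; rewrite row_free_unit => Qu.
move/(congr1 determinant); rewrite !det_mulmx mulrC => /mulIf; apply.
by move: Qu; rewrite unitmxE unitfE.
Qed.

Lemma det_mx33 (F : comNzRingType) (g : nat -> nat -> F) :
  \det (\matrix_(i < 3, j < 3) g i j) = g 0 0 * (g 1 1 * g 2 2 - g 1 2 * g 2 1)
    - g 0 1 * (g 1 0 * g 2 2 - g 1 2 * g 2 0)
    + g 0 2 * (g 1 0 * g 2 1 - g 1 1 * g 2 0) :> F.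
Proof.
rewrite (expand_det_row _ 0) !big_ord_recl big_ord0 addr0 /cofactor.
rewrite !(expand_det_row _ 0) !big_ord_recl !big_ord0 !addr0 /cofactor !det_mx11.
rewrite !mxE /= /bump /= !addn0 !add0n !expr0 !expr1 !exprS expr0.
ring.
Qed.

Section PureCubic.
Variables (F : fieldType) (E : fieldExtType F) (a : F) (t : E).
Hypotheses (t3 : t ^+ 3 = a%:A) (noncube : forall c, c ^+ 3 != a).

Local Notation h := (in_alg E).

Definition cubic (c0 c1 c2 : F) : E := h c0 + h c1 * t + h c2 * t ^+ 2.

Let t3h : t ^+ 3 = h a. Proof. exact: t3. Qed.

Lemma cubicM c0 c1 c2 d0 d1 d2 : cubic c0 c1 c2 * cubic d0 d1 d2
  = cubic (c0 * d0 + a * (c1 * d2 + c2 * d1)) (c0 * d1 + c1 * d0 + a * (c2 * d2))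
          (c0 * d2 + c1 * d1 + c2 * d0).
Proof. by rewrite /cubic !(rmorphD h, rmorphM h); ring: t3h. Qed.

Lemma cubic_adj c0 c1 c2 :
  cubic (c0 ^+ 2 - a * c1 * c2) (a * c2 ^+ 2 - c0 * c1) (c1 ^+ 2 - c0 * c2)
    * cubic c0 c1 c2 = h (nform a c0 c1 c2).
Proof.
rewrite cubicM -[RHS]addr0 -[RHS]addr0 -[X in _ = _ + X + _](mul0r t).
rewrite -[X in _ = _ + X](mul0r (t ^+ 2)) -(rmorph0 h).
by congr (h _ + h _ * _ + h _ * _); rewrite /nform; ring.
Qed.

Lemma cubic_inj0 c0 c1 c2 : cubic c0 c1 c2 = 0 -> [/\ c0 = 0, c1 = 0 & c2 = 0].
Proof.
move=> c_0; apply: (nform_anisotropic noncube).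
have /eqP : h (nform a c0 c1 c2) = 0 by rewrite -cubic_adj c_0 mulr0.
by rewrite fmorph_eq0 => /eqP.
Qed.

Hypothesis dimE : \dim {:E} = 3.

Definition cubic_basis : 3.-tuple E := [tuple 1; t; t ^+ 2].

Lemma cubic_basis_comb (k : 'I_3 -> F) : \sum_i k i *: cubic_basis`_i
  = cubic (k ord0) (k (lift ord0 ord0)) (k (lift ord0 (lift ord0 ord0))).
Proof.
rewrite !big_ord_recl big_ord0 /= addr0 /cubic addrA.
by rewrite /= !mulr_algl.
Qed.

Lemma cubic_basisP : basis_of {:E} cubic_basis.
Proof.
rewrite basisEfree subvf dimE size_tuple leqnn !andbT.
apply/freeP => k; rewrite cubic_basis_comb => /cubic_inj0[k0 k1 k2].
by case=> [[|[|[|?]]]] //= lti; [rewrite -[RHS]k0|rewrite -[RHS]k1|rewrite -[RHS]k2];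
  congr k; apply: val_inj.
Qed.

Definition cubic_coord (i : nat) (lti : (i < 3)%N) (z : E) : F :=
  coord cubic_basis (Ordinal lti) z.

Lemma cubic_coordE z : z = cubic (cubic_coord (isT : (0 < 3)%N) z)
  (cubic_coord (isT : (1 < 3)%N) z) (cubic_coord (isT : (2 < 3)%N) z).
Proof.
rewrite {1}(coord_basis cubic_basisP (memvf z)) cubic_basis_comb.
by congr cubic; congr (coord _ _ z); apply: val_inj.
Qed.

Lemma field_norm_cubic c0 c1 c2 : field_norm (cubic c0 c1 c2) = nform a c0 c1 c2.
Proof.
pose e := vbasis {:E}; have eP : basis_of {:E} e := vbasisP _.
(* the rows of g are the coordinates of z, z t and z t^2 in the basis 1, t, t^2 *)
pose g i j := nth 0 (nth [::]
  [:: [:: c0; c1; c2]; [:: a * c2; c0; c1]; [:: a * c1; a * c2; c0]] i) j.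
pose Q : 'M[F]_(3, \dim {:E}) := \matrix_(i < 3) rVof e cubic_basis`_i.
have QE (u : 'rV_3) : u *m Q = rVof e (\sum_i u 0 i *: cubic_basis`_i).
  rewrite linear_sum mulmx_sum_row; apply: eq_bigr => i _.
  by rewrite rowK linearZ.
rewrite /field_norm (@det_conjugate _ _ 3 _ (\matrix_(i < 3, j < 3) g i j) Q).
- by rewrite det_mx33 /g /nform /=; ring.
- by rewrite dimE.
- apply: inj_row_free => u; rewrite QE => /eqP; rewrite rVof_eq0 // => /eqP u0.
  have /freeP /(_ (u 0) u0) uE := basis_free cubic_basisP.
  by apply/rowP => i; rewrite uE mxE.
apply/row_matrixP => i; rewrite !row_mul QE rowK mul_mxof rVofK //.
congr (rVof e _); rewrite cubic_basis_comb !mxE /= lfunE /=.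
have -> : cubic_basis`_i = cubic (i == 0 :> nat)%:R (i == 1 :> nat)%:R (i == 2 :> nat)%:R.
  by case: i => [[|[|[|?]]]] //= lti; rewrite /cubic !rmorph0 !rmorph1; ring.
rewrite cubicM /g; case: i => [[|[|[|?]]]] //= lti; congr cubic; ring.
Qed.

End PureCubic.

(** * Extending an ultrametric absolute value to a pure cubic extension *)
Lemma prim3_natr3_neq0 (F : fieldType) (eps : F) :
  3.-primitive_root eps -> 3%:R != 0 :> F.
Proof.
move=> prim; have e3 := prim_expr_order prim.
apply/eqP => three0; have : (eps - 1) ^+ 3 = 0.
  have -> : (eps - 1) ^+ 3 = (eps ^+ 3 - 1) - 3%:R * (eps ^+ 2 - eps) by ring.
  by rewrite e3 three0 mul0r subrr subr0.
move/eqP; rewrite expf_eq0 /= subr_eq0 -[eps]expr1.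
by rewrite -(prim_order_dvd prim).
Qed.

Section CubicBound.
Variables (R : realType) (F : fieldType) (v : F -> R).
Hypotheses (vP : absolute_value v) (vU : ultrametric v) (v_complete : complete_for v).

(** A coefficient of maximal absolute value greater than 1 would make one edge
    of the Newton polygon split off a root. *)
Lemma rootless_cubic_bound A B C :
  (forall x, x ^+ 3 + A * x ^+ 2 + B * x + C != 0) -> v C <= 1 ->
  v A <= 1 /\ v B <= 1.
Proof.
move=> rootless C1.
have [AB|BA] := lerP (v A) (v B).
  suff B1 : v B <= 1 by split=> //; apply: le_trans AB B1.
  rewrite leNgt; apply/negP => B1; have B_gt0 := lt_trans ltr01 B1.
  have B0 : B != 0 by rewrite -(abs_gt0 vP).
  have [|||x xE] := hensel_cubic vP vU v_complete
    (p := - C / B) (q := - A / B) (s := - B^-1).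
  - by rewrite (abs_div vP) (absN vP) ltr_pdivrMr // mul1r (le_lt_trans C1).
  - by rewrite (abs_div vP) (absN vP) ler_pdivrMr // mul1r.
  - by rewrite (absN vP) (absV vP) invf_le1 // ltW.
  case/eqP: (rootless x).
  have : B * x = B * (- C / B + - A / B * x ^+ 2 + - B^-1 * x ^+ 3) by rewrite -xE.
  have -> : B * (- C / B + - A / B * x ^+ 2 + - B^-1 * x ^+ 3)
    = - C - A * x ^+ 2 - x ^+ 3 by field.
  by move=> ->; ring.
suff A1 : v A <= 1 by split=> //; apply: le_trans (ltW BA) A1.
rewrite leNgt; apply/negP => A1; have A_gt0 := lt_trans ltr01 A1.
have A0 : A != 0 by rewrite -(abs_gt0 vP).
pose d := B / A ^+ 2; pose e := C / A ^+ 3.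
have d1 : v d < 1.
  rewrite (abs_div vP) (absX vP) ltr_pdivrMr ?exprn_gt0 // mul1r (lt_le_trans BA) //.
  by rewrite ler_eXnr // ltW.
have e1 : v e < 1.
  rewrite (abs_div vP) (absX vP) ltr_pdivrMr ?exprn_gt0 // mul1r (le_lt_trans C1) //.
  by rewrite exprn_egt1.
pose u := 1 + d; have vu : v u = 1 by exact: ultra_add1.
have u0 : u != 0 by rewrite -(abs_gt0 vP) vu.
(* [X = A (Z - 1)]: the slope of the edge places a root of X / A near -1 *)
have [|||z zE] := hensel_cubic vP vU v_complete
  (p := (d - e) / u) (q := 2%:R / u) (s := - u^-1).
- by rewrite (abs_div vP) vu divr1 ultra_lt ?(absN vP).
- by rewrite (abs_div vP) vu divr1 ultra_nat_le.
- by rewrite (absN vP) (absV vP) vu invr1.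
case/eqP: (rootless (A * (z - 1))).
have : u * z = u * ((d - e) / u + 2%:R / u * z ^+ 2 + - u^-1 * z ^+ 3) by rewrite -zE.
have -> : u * ((d - e) / u + 2%:R / u * z ^+ 2 + - u^-1 * z ^+ 3)
  = d - e + 2%:R * z ^+ 2 - z ^+ 3 by field.
move=> uz; transitivity (A ^+ 3 * (u * z - (d - e + 2%:R * z ^+ 2 - z ^+ 3))).
  by rewrite /u /d /e; field.
by rewrite uz subrr mulr0.
Qed.

Lemma nform_add1 a c0 c1 c2 : (forall c, c ^+ 3 != a) ->
  v (nform a c0 c1 c2) <= 1 -> v (nform a (1 + c0) c1 c2) <= 1.
Proof.
move=> noncube n1.
pose A := - (3%:R * c0); pose B := 3%:R * (c0 ^+ 2 - a * c1 * c2).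
pose C := - nform a c0 c1 c2.
(* the characteristic polynomial of multiplication by the element *)
have charE x : x ^+ 3 + A * x ^+ 2 + B * x + C = nform a (x - c0) (- c1) (- c2).
  by rewrite /A /B /C /nform; ring.
suff [A1 B1] : v A <= 1 /\ v B <= 1.
  have -> : nform a (1 + c0) c1 c2 = 1 - A + B - C.
    by rewrite /A /B /C /nform; ring.
  have C1 : v C <= 1 by rewrite (absN vP).
  by do 3?[apply: (ultra_le vU)]; rewrite ?(absN vP A) ?(absN vP C) ?(abs1 vP).
have [/andP[/eqP c1_0 /eqP c2_0]|c12] := boolP ((c1 == 0) && (c2 == 0)).
  have c01 : v c0 <= 1.
    have nE : nform a c0 c1 c2 = c0 ^+ 3 by rewrite /nform c1_0 c2_0; ring.
    by move: n1; rewrite nE (absX vP) expr_le1 ?(abs_ge0 vP).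
  have three1 := ultra_nat_le vP vU 3.
  rewrite (absN vP) /B c1_0 mulr0 mul0r subr0 !(absM vP).
  by rewrite !mulr_ile1 ?mulr_ge0 ?(abs_ge0 vP).
apply: (@rootless_cubic_bound _ _ C); last by rewrite (absN vP).
move=> x; rewrite charE; apply: contra c12 => /eqP /(nform_anisotropic noncube)[_].
by move=> /eqP; rewrite oppr_eq0 => -> /eqP; rewrite oppr_eq0.
Qed.

End CubicBound.

(** Without locking, unification compares norm absolute values by unfolding
    determinants and real exponentials. *)
HB.lock Definition norm_abs (R : realType) (F : fieldType) (v : F -> R)
    (E : fieldExtType F) (z : E) : R := v (field_norm z) `^ 3^-1.

Section NormAbs.
Variables (R : realType) (F : fieldType) (v : F -> R) (E : fieldExtType F).
Variables (a : F) (t : E) (eps : F).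
Hypotheses (vP : absolute_value v) (vU : ultrametric v) (v_complete : complete_for v).
Hypotheses (t3 : t ^+ 3 = a%:A) (noncube : forall c, c ^+ 3 != a).
Hypotheses (dimE : \dim {:E} = 3) (prim : 3.-primitive_root eps).
Local Notation N := (@field_norm F E).

Local Notation norm_abs := (@norm_abs R F v E).

Let norm_absE z : norm_abs z = v (N z) `^ 3^-1. Proof. by rewrite unlock. Qed.

Let coordE z : exists c0 c1 c2, z = cubic t c0 c1 c2.
Proof. by rewrite (cubic_coordE t3 noncube dimE z); do 3!eexists. Qed.

Lemma field_norm_eq0 z : (N z == 0) = (z == 0).
Proof.
have [c0 [c1 [c2 ->]]] := coordE z; rewrite (field_norm_cubic t3) //.
apply/eqP/eqP => [/(nform_anisotropic noncube)[-> -> ->]|/(cubic_inj0 t3 noncube)[-> -> ->]].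
  by rewrite /cubic !rmorph0 !mul0r !addr0.
by rewrite /nform !expr0n /= !mulr0 !addr0 subr0.
Qed.

(** Dividing by the element of larger norm reduces to adding 1 to an element
    whose norm has absolute value at most 1. *)
Lemma field_norm_ultrametric : ultrametric (v \o N).
Proof.
move=> x y /=; wlog le_xy : x y / v (N x) <= v (N y) => [H|].
  case/orP: (le_total (v (N x)) (v (N y))) => le_xy; first exact: H.
  by rewrite addrC maxC; apply: H.
rewrite (max_idPr le_xy); have [y0|y0] := eqVneq y 0; first by rewrite {1}y0 addr0.
have Ny : 0 < v (N y) by rewrite (abs_gt0 vP) field_norm_eq0.
rewrite -[x](divfK y0) -[X in _ * y + X]mul1r -mulrDl field_normM (absM vP).
rewrite ler_piMl ?(abs_ge0 vP) // addrC.
have : v (N (x / y)) <= 1.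
  rewrite -(ler_pM2r Ny) mul1r -(absM vP) -field_normM divfK //.
have [c0 [c1 [c2 ->]]] := coordE (x / y).
have -> : 1 + cubic t c0 c1 c2 = cubic t (1 + c0) c1 c2.
  by rewrite /cubic rmorphD rmorph1 !addrA.
by rewrite !(field_norm_cubic t3) //; apply: nform_add1.
Qed.

Let third0 : 0 <= 3^-1 :> R. Proof. by rewrite invr_ge0. Qed.
Let cubeK (x : R) : 0 <= x -> (x ^+ 3) `^ 3^-1 = x.
Proof. by move=> x0; rewrite -powR_mulrn // -powRrM divff ?powRr1 // pnatr_eq0. Qed.

Lemma norm_abs_ultrametric : ultrametric norm_abs.
Proof.
move=> x y; have := field_norm_ultrametric x y; rewrite !norm_absE /=.
rewrite !le_max => /orP[H|H]; apply/orP; [left|right];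
by apply: ge0_ler_powR; rewrite ?qualifE ?nnegrE /= ?(abs_ge0 vP).
Qed.

Lemma norm_absM x y : norm_abs (x * y) = norm_abs x * norm_abs y.
Proof. by rewrite !norm_absE field_normM (absM vP) powRM ?(abs_ge0 vP). Qed.

Lemma norm_abs_scalar k : norm_abs (in_alg E k) = v k.
Proof. by rewrite !norm_absE field_norm_scalar dimE (absX vP) cubeK ?(abs_ge0 vP). Qed.

Lemma norm_abs_eq x y : N x = N y -> norm_abs x = norm_abs y.
Proof. by rewrite !norm_absE => ->. Qed.

Lemma norm_abs_ge0 x : 0 <= norm_abs x.
Proof. by rewrite norm_absE powR_ge0. Qed.

Lemma norm_abs_eq0 x : norm_abs x = 0 <-> x = 0.
Proof.
rewrite !norm_absE; split=> [/powR_eq0_eq0/eqP|->].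
  by rewrite (abs_eq0 vP) field_norm_eq0 => /eqP.
rewrite (eqP (etrans (field_norm_eq0 0) (eqxx 0))) (abs0 vP) powR0 //.
by rewrite invr_neq0 // pnatr_eq0.
Qed.

Lemma norm_absP : absolute_value norm_abs.
Proof.
split; [exact: norm_abs_ge0 | exact: norm_abs_eq0 | exact: norm_absM |].
move=> x y; apply: le_trans (norm_abs_ultrametric x y) _.
have x0 := norm_abs_ge0 x; have y0 := norm_abs_ge0 y.
by move: (norm_abs x) (norm_abs y) x0 y0 => p q p0 q0; rewrite ge_max lerDl lerDr q0 p0.
Qed.

(** The three conjugates have the same norm, and the coordinates are recovered
    from them by averaging against the characters of the Galois group. *)
Lemma norm_abs_coord : exists2 D : R, 0 < D & forall c0 c1 c2,
  [/\ v c0 <= D * norm_abs (cubic t c0 c1 c2),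
      v c1 <= D * norm_abs (cubic t c0 c1 c2) &
      v c2 <= D * norm_abs (cubic t c0 c1 c2)].
Proof.
have nU := norm_abs_ultrametric; have nP := norm_absP.
have e2 := prim3_sqr prim; have e3 := prim_expr_order prim.
have three0 := prim3_natr3_neq0 prim.
have t0 : t != 0.
  apply/eqP => t0; have := t3; rewrite t0 expr0n /= => /esym/eqP.
  rewrite (fmorph_eq0 (in_alg E)) => /eqP a0.
  by have := noncube 0; rewrite expr0n a0 eqxx.
have veps : v eps = 1 by exact: (abs_root1 vP) e3.
have v3 : 0 < v 3%:R by rewrite (abs_gt0 vP).
have [T TE T0] : exists2 T, norm_abs t = T & 0 < T.
  by exists (norm_abs t); rewrite ?(abs_gt0 nP).
pose d i := (v 3%:R * T ^+ i)^-1.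
have d0 i : 0 < d i by rewrite invr_gt0 mulr_gt0 ?exprn_gt0.
exists (d 0 + d 1 + d 2); first by rewrite !addr_gt0.
move=> c0 c1 c2; set z := cubic t c0 c1 c2; have z0 : 0 <= norm_abs z := abs_ge0 nP z.
pose z1 := cubic t c0 (eps * c1) (eps ^+ 2 * c2).
pose z2 := cubic t c0 (eps ^+ 2 * c1) (eps * c2).
have nz1 : norm_abs z1 = norm_abs z.
  apply: norm_abs_eq; rewrite /z1 /z !(field_norm_cubic t3 noncube dimE) /nform; ring: e3.
have nz2 : norm_abs z2 = norm_abs z.
  apply: norm_abs_eq; rewrite /z2 /z !(field_norm_cubic t3 noncube dimE) /nform; ring: e3.
have h2 : in_alg E eps ^+ 2 = - 1 - in_alg E eps.
  by rewrite -rmorphXn e2 rmorphB rmorphN rmorph1.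
have unit_le k w M : v k = 1 -> norm_abs w = M -> norm_abs (in_alg E k * w) <= M.
  by move=> k1 <-; rewrite norm_absM norm_abs_scalar k1 mul1r lexx.
have combine (k k' : F) (w : E) : v k = 1 -> v k' = 1 ->
    w = z + in_alg E k * z1 + in_alg E k' * z2 -> norm_abs w <= norm_abs z.
  move=> k1 k'1 ->; apply: (ultra_le nU); last exact: unit_le k'1 nz2.
  apply: (ultra_le nU); [exact: lexx | exact: unit_le k1 nz1].
have scale_le c i M : (i < 3)%N -> 0 <= M ->
    norm_abs (in_alg E (3%:R * c) * t ^+ i) <= M -> v c <= (d 0 + d 1 + d 2) * M.
  move=> lti M0; rewrite norm_absM norm_abs_scalar (absX nP) TE (absM vP) mulrAC mulrC.
  move=> H; apply: (@le_trans _ _ (d i * M)).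
    by rewrite /d ler_pdivlMl ?mulr_gt0 ?exprn_gt0 // mulrC.
  rewrite ler_wpM2r //.
  by case: i lti {H} => [|[|[|?]]] // _; have := (d0 0, d0 1, d0 2) => -[[? ?] ?]; lra.
have hE := (rmorphM (in_alg E), rmorphXn (in_alg E), rmorph1 (in_alg E),
  rmorph_nat (in_alg E)).
have X2 : v (eps ^+ 2) = 1 by rewrite (absX vP) veps expr1n.
split.
- apply: (scale_le _ 0 _ isT z0); apply: (combine 1 1); rewrite ?(abs1 vP) //.
  by rewrite /z /z1 /z2 /cubic !hE; ring: h2.
- apply: (scale_le _ 1 _ isT z0); apply: (combine (eps ^+ 2) eps) => //.
  by rewrite /z /z1 /z2 /cubic !hE; ring: h2.
- apply: (scale_le _ 2 _ isT z0); apply: (combine eps (eps ^+ 2)) => //.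
  by rewrite /z /z1 /z2 /cubic !hE; ring: h2.
Qed.

Lemma norm_abs_close (e : R) : 0 < e -> exists2 e' : R, 0 < e' &
  forall c0 c1 c2 l0 l1 l2, v (c0 - l0) < e' -> v (c1 - l1) < e' -> v (c2 - l2) < e' ->
  norm_abs (cubic t c0 c1 c2 - cubic t l0 l1 l2) < e.
Proof.
have nP := norm_absP; move=> e0.
set T := norm_abs t; have T0 : 0 <= T := abs_ge0 nP t.
have K0 : 0 < 1 + T + T ^+ 2 by rewrite -addrA ltr_pwDl // addr_ge0 ?exprn_ge0.
have e'0 := divr_gt0 e0 K0; set e' := e / _ in e'0.
exists e' => // c0 c1 c2 l0 l1 l2 lt0 lt1 lt2.
have -> : cubic t c0 c1 c2 - cubic t l0 l1 l2
  = in_alg E (c0 - l0) + in_alg E (c1 - l1) * t + in_alg E (c2 - l2) * t ^+ 2.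
  by rewrite /cubic !rmorphB; ring.
apply: le_lt_trans (absD3 nP _ _ _) _; rewrite !norm_absM !norm_abs_scalar -/T.
have -> : e = e' + e' * T + e' * (T * T).
  by rewrite -[e](divfK (lt0r_neq0 K0)) -/e'; ring.
apply: ltr_leD; last by rewrite ler_wpM2r ?mulr_ge0 // ltW.
by apply: ltr_leD => //; rewrite ler_wpM2r // ltW.
Qed.

Lemma norm_abs_complete : complete_for norm_abs.
Proof.
have nP := norm_absP; have [D D0 DP] := norm_abs_coord.
move=> u uC.
have coordC i (lti : (i < 3)%N) :
    exists l, converges_for v (fun n => cubic_coord t lti (u n)) l.
  apply: v_complete => e e0; have [n nn] := uC _ (divr_gt0 e0 D0).
  exists n => j k nj nk; have := nn j k nj nk; rewrite ltr_pdivlMr // mulrC.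
  apply: le_lt_trans; rewrite /cubic_coord -raddfB -/(cubic_coord t lti (u j - u k)).
  have := cubic_coordE t3 noncube dimE (u j - u k).
  set c0 := cubic_coord _ _ _; set c1 := cubic_coord _ _ _; set c2 := cubic_coord _ _ _.
  move=> zE; have := DP c0 c1 c2; rewrite -zE => -[? ? ?].
  by case: i lti => [|[|[|?]]] // lti; rewrite (bool_irrelevance lti isT).
have [l0 l0P] := coordC 0 isT; have [l1 l1P] := coordC 1 isT; have [l2 l2P] := coordC 2 isT.
exists (cubic t l0 l1 l2) => e /norm_abs_close[e' e'0 close].
have [n0 P0] := l0P _ e'0; have [n1 P1] := l1P _ e'0; have [n2 P2] := l2P _ e'0.
exists (maxn n0 (maxn n1 n2)) => n; rewrite !geq_max => /and3P[nn0 nn1 nn2].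
rewrite {1}(cubic_coordE t3 noncube dimE (u n)).
by apply: close; [exact: P0 | exact: P1 | exact: P2].
Qed.

End NormAbs.

(** * Embeddings of simple extensions *)
Section ExtendEmbedding.
Variables (K : fieldType) (L : fieldExtType K) (theta : L).
Hypothesis L_gen : <<1; theta>>%VS = fullv.

Lemma minPoly1P : exists2 q : {poly K}, map_poly (in_alg L) q = minPoly 1 theta &
  forall p, root (map_poly (in_alg L) p) theta -> q %| p.
Proof.
have /polyOver1P[q qE] := minPolyOver 1%AS theta; exists q; first exact: esym.
move=> p root_p; rewrite -(dvdp_map (in_alg L)) /= -qE.
by apply: minPoly_dvdp => //; apply: alg_polyOver.
Qed.

(** Since [L = K[X]/(q)], a root of the image of [q] is all that is needed to
    extend [h]. *)
Lemma extend_embedding (E : fieldType) (h : {rmorphism K -> E}) (s : E) :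
  (forall p, root (map_poly (in_alg L) p) theta -> root (map_poly h p) s) ->
  exists g : {rmorphism L -> E}, (forall k, g k%:A = h k) /\ g theta = s.
Proof.
move=> sP.
have /choice[rep repP] (z : L) : exists p, z = (map_poly (in_alg L) p).[theta].
  by apply/Fadjoin1_polyP; rewrite L_gen memvf.
pose g z := (map_poly h (rep z)).[s].
have gE p : g (map_poly (in_alg L) p).[theta] = (map_poly h p).[s].
  apply/eqP; rewrite /g; set q := rep _; rewrite -subr_eq0 -hornerN -hornerD -rmorphB.
  by apply: sP; rewrite /root rmorphB /= hornerD hornerN -repP subrr.
have g_add : zmod_morphism g.
  move=> y z; rewrite {1}(repP y) {1}(repP z) -hornerN -hornerD -rmorphB gE.
  by rewrite rmorphB /= hornerD hornerN.
have g_mul : monoid_morphism g.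
  split=> [|y z].
    have -> : 1 = (map_poly (in_alg L) 1).[theta] by rewrite rmorph1 hornerC.
    by rewrite gE rmorph1 hornerC.
  by rewrite {1}(repP y) {1}(repP z) -hornerM -rmorphM gE rmorphM /= hornerM.
pose gA := GRing.isZmodMorphism.Build L E g g_add.
pose gM := GRing.isMonoidMorphism.Build L E g g_mul.
pose gR : {rmorphism L -> E} := HB.pack g gA gM.
exists gR; split=> [k|] /=.
  have -> : k%:A = (map_poly (in_alg L) k%:P).[theta] by rewrite map_polyC hornerC.
  by rewrite gE map_polyC hornerC.
have {1}-> : theta = (map_poly (in_alg L) 'X).[theta] by rewrite map_polyX hornerX.
by rewrite gE map_polyX hornerX.
Qed.

(** The minimal polynomial of [theta] divides [X^3 - alpha], which splits over [E]
    with roots [eps^i c]. Only one of these roots, not necessarily [c], has to be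
    a root of it. *)
Lemma extend_embedding_cubic (E : fieldType) (h : {rmorphism K -> E}) (eps c : E) alpha :
  3.-primitive_root eps -> theta ^+ 3 = alpha%:A -> c ^+ 3 = h alpha ->
  exists g : {rmorphism L -> E}, forall k, g k%:A = h k.
Proof.
move=> prim theta3 c3; have [q qE qP] := minPoly1P.
have e2 := prim3_sqr prim.
pose f := ('X - c%:P) * (('X - (eps * c)%:P) * ('X - (eps ^+ 2 * c)%:P)).
have dvd_q : map_poly h q %| f.
  have -> : f = map_poly h ('X^3 - alpha%:P).
    rewrite rmorphB /= map_polyXn map_polyC /= -c3 /f e2 !polyCM polyCB polyCN polyC1.
    have E2 : eps%:P ^+ 2 = -1 - eps%:P :> {poly E}.
      by rewrite -polyC_exp e2 polyCB polyCN.
    by ring: E2.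
  rewrite dvdp_map; apply: qP; rewrite rmorphB /= map_polyXn map_polyC /=.
  by rewrite /root !hornerE theta3 subrr.
have [s root_s] : exists s, root (map_poly h q) s.
  apply: contrapT => /forallNP noroot.
  have cop x : coprimep (map_poly h q) ('X - x%:P).
    by rewrite coprimep_XsubC; apply/negP/noroot.
  have : coprimep (map_poly h q) f by rewrite !coprimepMr !cop.
  rewrite coprimep_sym => /(coprimep_dvdr dvd_q); rewrite coprimepp size_map_poly.
  by rewrite -(size_map_poly (in_alg L)) /= qE size_minPoly eqSS.
have [p /qP/dvdpP[d ->]|g [gE _]] := @extend_embedding E h s; last by exists g.
by rewrite rmorphM /= rootM root_s orbT.
Qed.

End ExtendEmbedding.

(** [X^3 - a] has no root, hence is irreducible. *)
Lemma dim_pure_cubic (F : fieldType) (E : fieldExtType F) (a : F) (t : E) :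
  t ^+ 3 = a%:A -> (forall c, c ^+ 3 != a) -> \dim <<1; t>>%VS = 3.
Proof.
move=> t3 noncube; rewrite dim_Fadjoin dimv1 muln1.
have [q qE qP] := minPoly1P t.
have szX : size ('X^3 - a%:P) = 4 by rewrite size_XnsubC.
have irr : irreducible_poly ('X^3 - a%:P).
  apply: cubic_irreducible; rewrite ?szX // => x.
  by rewrite /root !hornerE subr_eq0 noncube.
have : q %= 'X^3 - a%:P.
  apply: irr.2.
    by rewrite -(size_map_poly (in_alg E)) /= qE size_minPoly eqSS.
  apply: qP; rewrite rmorphB /= map_polyXn map_polyC /=.
  by rewrite /root !hornerE t3 subrr.
move/eqp_size; rewrite szX -(size_map_poly (in_alg E)) /= qE size_minPoly.
by move=> /eqP; rewrite eqSS => /eqP.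
Qed.

(** * Local degree at a place above an ultrametric one *)
Section LocalDegree.
Variables (R : realType) (F : fieldType) (v : F -> R) (E : fieldExtType F) (aw : E -> R).
Variables (a eps : F) (t : E).
Hypotheses (vP : absolute_value v) (vU : ultrametric v) (v_complete : complete_for v).
Hypotheses (awP : absolute_value aw) (aw_above : lies_above aw v).
Hypotheses (t3 : t ^+ 3 = a%:A) (noncube : forall c, c ^+ 3 != a).
Hypotheses (prim : 3.-primitive_root eps).
Hypothesis dense : forall z (e : R), 0 < e -> exists2 y, y \in <<1; t>>%VS & aw (z - y) < e.

Local Notation U := (<<1; t>>%AS).
Local Notation M := (subvs_of U).

(** An absolute value above [v] is, up to an exponent, the norm absolute value
    on the cubic subfield. Completeness makes this subfield closed, and it is
    dense. *)
Lemma dense_pure_cubic_full : <<1; t>>%VS = fullv.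
Proof.
pose tM : M := Subvs (memv_adjoin 1 t).
have tM3 : tM ^+ 3 = a%:A by apply: val_inj; rewrite rmorphXn /= t3 algid1.
have dimM : \dim {:M} = 3 by rewrite dimvf -(dim_pure_cubic t3 noncube).
pose n : M -> R := @norm_abs R F v M.
have nP : absolute_value n := norm_absP vP vU v_complete tM3 noncube dimM.
have [s [s0 sP]] := aw_above.
have [D D0 DP] := norm_abs_coord vP vU v_complete tM3 noncube dimM prim.
have le_pow (x y : R) : 0 <= x -> x <= y -> x `^ s <= y `^ s.
  by move=> x0 xy; apply: ge0_ler_powR; rewrite ?nnegrE ?(le_trans x0 xy) // ltW.
(* the easy comparison, with a constant, from the coordinates *)
have [C C0 CP] : exists2 C, 0 <= C & forall z : M, aw (vsval z) <= C * n z `^ s.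
  exists (D `^ s * (1 + aw t + aw t * aw t)) => [|z].
    by rewrite mulr_ge0 ?powR_ge0 // !addr_ge0 ?mulr_ge0 ?(abs_ge0 awP).
  rewrite (cubic_coordE tM3 noncube dimM z).
  set c0 := cubic_coord _ _ _; set c1 := cubic_coord _ _ _; set c2 := cubic_coord _ _ _.
  have [le0 le1 le2] := DP c0 c1 c2; set z' := cubic tM c0 c1 c2 in le0 le1 le2 *.
  have -> : vsval z' = c0%:A + c1%:A * t + c2%:A * t ^+ 2.
    by rewrite /z' /cubic !rmorphD !rmorphM /= algid1.
  have coef c : v c <= D * n z' -> aw c%:A <= D `^ s * n z' `^ s.
    move=> le_c; rewrite sP -powRM ?(abs_ge0 nP) ?(ltW D0) //.
    by apply: le_pow le_c; apply: abs_ge0.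
  apply: le_trans (absD3 awP _ _ _) _; rewrite !(absM awP) mulrAC !mulrDr mulr1.
  move: (coef c0 le0) (coef c1 le1) (coef c2 le2) => b0 b1 b2.
  by rewrite !lerD // ler_wpM2r ?mulr_ge0 ?(abs_ge0 awP).
have n_ge0 z : 0 <= n z `^ s by exact: powR_ge0.
(* applied to z^m, the comparison holds without the constant; then apply it to z^-1 *)
have aw_le z : aw (vsval z) <= n z `^ s.
  apply: (@ler_of_expr_bound _ _ _ C) => [|//|//|m]; first exact: abs_ge0.
  have -> : (n z `^ s) ^+ m = n (z ^+ m) `^ s.
    by rewrite (absX nP) powR_exprn ?(abs_ge0 nP).
  rewrite -(absX awP) -rmorphXn; apply: le_trans (CP _) _.
  by rewrite ler_wpM2r // ler_peMr // ler1n.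
have le_aw z : n z `^ s <= aw (vsval z).
  have [->|z0] := eqVneq z 0; first by rewrite (abs0 nP) powR0 ?(gt_eqF s0) ?(abs_ge0 awP).
  have nz0 : 0 < n z `^ s by rewrite powR_gt0 // (abs_gt0 nP).
  have awz0 : 0 < aw (vsval z) by rewrite (abs_gt0 awP) fmorph_eq0.
  have := aw_le z^-1; rewrite fmorphV (absV awP) (absV nP) powR_invr ?(abs_ge0 nP) //.
  by rewrite lef_pV2.
have n_complete := norm_abs_complete vP vU v_complete tM3 noncube dimM prim.
apply/vspaceP => z; rewrite memvf; apply/idP.
have /choice[y yP] (k : nat) : exists y : M, aw (z - vsval y) < k.+1%:R^-1.
  have [|y yU lt_y] := dense z (e := k.+1%:R^-1); first by rewrite invr_gt0.
  by exists (Subvs yU).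
have y_lim : converges_for aw (fun k => vsval (y k)) z.
  move=> e e0; exists (Num.bound e^-1) => k le_k; rewrite (absB awP).
  apply: lt_trans (yP k) _; rewrite invf_plt ?posrE //.
  apply: lt_le_trans (Num.Theory.archi_boundP _) _; first by rewrite invr_ge0 ltW.
  by rewrite ler_nat (leq_trans le_k).
have y_cauchy : cauchy_for n y.
  move=> e e0; have es0 : 0 < e `^ s by rewrite powR_gt0.
  have [k kP] := converges_cauchy awP y_lim es0; exists k => i j ki kj.
  rewrite ltNge; apply/negP => /(le_pow _ _ (ltW e0)).
  by apply/negP; rewrite -ltNge (le_lt_trans (le_aw _)) // rmorphB kP.
have [l lP] := n_complete y y_cauchy.
suff -> : z = vsval l by apply: subvsP.
apply: (converges_unique awP y_lim) => e e0.
have es0 : 0 < e `^ s^-1 by rewrite powR_gt0.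
have [k kP] := lP _ es0; exists k => i ki.
rewrite -rmorphB (le_lt_trans (aw_le _)) //.
have -> : e = (e `^ s^-1) `^ s by rewrite -powRrM mulVf ?gt_eqF // powRr1 // ltW.
by apply: gt0_ltr_powR; rewrite ?nnegrE ?(abs_ge0 nP) ?powR_ge0 ?kP.
Qed.
End LocalDegree.

(** * Places of the global cubic extension *)
Section LocalConditions.
Variables (R : realType) (K : fieldExtType rat) (v : K -> R).
Variables (Kv : fieldType) (av : Kv -> R) (iv : {rmorphism K -> Kv}).
Hypotheses (v_prime : prime_of v) (Kv_completion : is_completion v av iv).
Variables (eps : Kv) (eps_prim : 3.-primitive_root eps) (alpha : K).
Variables (L : fieldExtType K) (theta : L).
Hypotheses (theta_cube : theta ^+ 3 = alpha%:A) (L_gen : <<1; theta>>%VS = fullv).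

Let avP : absolute_value av. Proof. by case: Kv_completion. Qed.
Let av_iv x : av (iv x) = v x. Proof. by case: Kv_completion. Qed.
Let iv_dense z e : 0 < e -> exists x, av (z - iv x) < e.
Proof. by case: Kv_completion => _ _ d _; apply: d. Qed.
Let av_complete : complete_for av. Proof. by case: Kv_completion. Qed.

(** In the archimedean case [Kv] contains an algebraically closed field to
    which the algebraic number [alpha] belongs. *)
Lemma noncube_ultrametric : (forall c, c ^+ 3 != iv alpha) -> ultrametric av.
Proof.
move=> noncube; apply: abs_ultrametric avP _ => n; rewrite leNgt; apply/negP => n1.
have [c /eqP] := archimedean_cube_root iv avP av_complete n1 eps_prim alpha.
by rewrite (negPf (noncube c)).
Qed.

Lemma restriction_prime (E : fieldType) (w : E -> R) (g : {rmorphism L -> E}) :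
  absolute_value w -> (forall k, w (g k%:A) = v k) ->
  prime_of (w \o g) /\ lies_above (w \o g) v.
Proof.
move=> wP wv; split.
  split; first exact: comp_absolute_value.
  case: v_prime => _ [x [x0 vx]]; exists x%:A; rewrite /= wv; split=> //.
  by rewrite scaler_eq0 oner_eq0 orbF.
exists 1; split=> // x; rewrite /= wv powRr1 // -av_iv; exact: abs_ge0.
Qed.

(** Here [L] embeds into [Kv], which is then itself a completion of [L]: all of
    [Kv] consists of norms. *)
Lemma cube_local_norm (beta : Kv) c : c ^+ 3 = iv alpha ->
  exists (w : L -> R) (Lw : fieldExtType Kv) (aw : Lw -> R) (iw : {rmorphism L -> Lw}),
    [/\ prime_of w, lies_above w v, is_completion w aw iw,
        is_local_extension av iv aw iw & exists z : Lw, beta = field_norm z].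
Proof.
move=> c3; have [g gE] := extend_embedding_cubic L_gen eps_prim theta_cube c3.
have [|gP gv] := @restriction_prime Kv av g avP; first by move=> k; rewrite gE av_iv.
exists (av \o g), Kv^o, av, g; split=> //.
- split=> // z e /(iv_dense z)[x lt_x].
  by exists x%:A; rewrite gE.
- split=> [x|]; first by rewrite gE -[LHS]mulr1.
  by exists 1; split=> // x; rewrite powRr1 ?(abs_ge0 avP) // -[_%:A]/(x * 1) mulr1.
exists (beta : Kv^o); have -> : (beta : Kv^o) = beta%:A by rewrite -[LHS]mulr1.
by rewrite field_norm_scalar regular_fullv dimv1 expr1 -[LHS]/(beta * 1) mulr1.
Qed.

(** The cubic extension of [Kv], with its norm absolute value, is a completion of
    [L]: the coordinates of an element can be approximated in [K]. *)
Lemma noncube_local_norm (c0 c1 c2 : Kv) : (forall c, c ^+ 3 != iv alpha) ->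
  exists (w : L -> R) (Lw : fieldExtType Kv) (aw : Lw -> R) (iw : {rmorphism L -> Lw}),
    [/\ prime_of w, lies_above w v, is_completion w aw iw,
        is_local_extension av iv aw iw &
        exists z : Lw, nform (iv alpha) c0 c1 c2 = field_norm z].
Proof.
move=> noncube; have avU := noncube_ultrametric noncube.
have irr : irreducible_poly ('X^3 - (iv alpha)%:P).
  apply: cubic_irreducible; rewrite ?size_XnsubC // => x.
  by rewrite /root !hornerE subr_eq0.
have [E dimE [s root_s _]] := irredp_FAdjoin irr.
rewrite size_XnsubC // /= in dimE.
have s3 : s ^+ 3 = (in_alg E \o iv) alpha.
  move: root_s; rewrite rmorphB /= map_polyXn map_polyC /= /root !hornerE subr_eq0.
  by move/eqP.
have epsE : 3.-primitive_root (in_alg E eps) by rewrite fmorph_primitive_root.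
have [g gE] := extend_embedding_cubic L_gen epsE theta_cube s3.
pose t := g theta; have t3 : t ^+ 3 = (iv alpha)%:A.
  by rewrite -rmorphXn theta_cube gE.
have nP := norm_absP avP avU av_complete t3 noncube dimE.
pose n := @norm_abs R Kv av E.
have [|gP gv] := @restriction_prime E n g nP.
  by move=> k; rewrite gE -av_iv; exact: (norm_abs_scalar avP dimE).
exists (n \o g), E, n, g; split=> //.
- split=> //; last exact: (norm_abs_complete avP avU av_complete t3 noncube dimE eps_prim).
  move=> z e e0; rewrite (cubic_coordE t3 noncube dimE z).
  have [e' e'0 close] := norm_abs_close avP avU av_complete t3 noncube dimE e0.
  set d0 := cubic_coord _ _ _; set d1 := cubic_coord _ _ _; set d2 := cubic_coord _ _ _.
  have [x0 lt0] := iv_dense d0 e'0; have [x1 lt1] := iv_dense d1 e'0.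
  have [x2 lt2] := iv_dense d2 e'0.
  exists (x0%:A + x1%:A * theta + x2%:A * theta ^+ 2).
  have -> : g (x0%:A + x1%:A * theta + x2%:A * theta ^+ 2) = cubic t (iv x0) (iv x1) (iv x2).
    by rewrite !rmorphD !rmorphM /= !gE.
  exact: close.
- split; first by move=> x; rewrite gE.
  exists 1; split=> // x; rewrite powRr1 ?(abs_ge0 avP) //.
  exact: (norm_abs_scalar avP dimE).
by exists (cubic t c0 c1 c2); rewrite (field_norm_cubic t3 noncube dimE).
Qed.

(** When [alpha] is not a cube, every completion of [L] above [v] is the cubic
    extension of [Kv] generated by [theta], whose norm is the norm form. *)
Lemma local_norm_nform (w : L -> R) (Lw : fieldExtType Kv) (aw : Lw -> R)
    (iw : {rmorphism L -> Lw}) (z : Lw) :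
  (forall c, c ^+ 3 != iv alpha) ->
  is_completion w aw iw -> is_local_extension av iv aw iw ->
  exists c0 c1 c2, field_norm z = nform (iv alpha) c0 c1 c2.
Proof.
move=> noncube [awP _ iw_dense _] [iwE aw_above].
have avU := noncube_ultrametric noncube.
pose t := iw theta; have t3 : t ^+ 3 = (iv alpha)%:A.
  by rewrite -rmorphXn theta_cube iwE.
have full : <<1; t>>%VS = fullv.
  apply: (dense_pure_cubic_full avP avU av_complete awP aw_above t3 noncube eps_prim).
  move=> y e /(iw_dense y)[x lt_x]; exists (iw x) => //.
  have /Fadjoin1_polyP[p ->] : x \in <<1; theta>>%VS by rewrite L_gen memvf.
  apply/Fadjoin1_polyP; exists (map_poly iv p); rewrite -horner_map -!map_poly_comp.
  congr _.[_]; apply: eq_map_poly => k; exact: iwE.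
have dimLw : \dim {:Lw} = 3 by rewrite -full (dim_pure_cubic t3 noncube).
rewrite (cubic_coordE t3 noncube dimLw z) (field_norm_cubic t3 noncube dimLw).
by do 3!eexists.
Qed.

End LocalConditions.

Theorem proposition3p1 (R : realType) (K : fieldExtType rat)
  (v : K -> R) (v_prime : prime_of v)
  (Kv : fieldType) (av : Kv -> R) (iv : {rmorphism K -> Kv})
  (Kv_completion : is_completion v av iv)
  (eps : Kv) (eps_prim : 3.-primitive_root eps)
  (alpha : K) (alpha_neq0 : alpha != 0) (beta : Kv) (beta_neq0 : beta != 0)
  (L : fieldExtType K) (theta : L) (theta_cube : theta ^+ 3 = alpha%:A)
  (L_gen : <<1; theta>>%VS = fullv) :
  division_algebra (symbol_algebra (iv alpha) beta eps_prim)
  <->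
  (forall w : L -> R, prime_of w -> lies_above w v ->
   forall (Lw : fieldExtType Kv) (aw : Lw -> R) (iw : {rmorphism L -> Lw}),
     is_completion w aw iw -> is_local_extension av iv aw iw ->
     ~ (exists z : Lw, z != 0 /\ beta = field_norm z)).
Proof.
split=> [divA w _ _ Lw aw iw compl ext [z [_ betaE]]|no_norm].
  have noncube c : c ^+ 3 != iv alpha.
    by apply/eqP => c3; apply: symbol_cube_not_division c3 divA.
  have [c0 [c1 [c2 nE]]] :=
    local_norm_nform Kv_completion eps_prim theta_cube L_gen z noncube compl ext.
  by apply: symbol_norm_not_division divA; rewrite betaE nE.
apply: contrapT => not_div.
suff [w [Lw [aw [iw [w_prime above compl ext [z betaE]]]]]] :
    exists (w : L -> R) (Lw : fieldExtType Kv) (aw : Lw -> R) (iw : {rmorphism L -> Lw}),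
    [/\ prime_of w, lies_above w v, is_completion w aw iw,
        is_local_extension av iv aw iw & exists z : Lw, beta = field_norm z].
  apply: (no_norm w w_prime above Lw aw iw compl ext); exists z; split=> //.
  apply: contraNneq beta_neq0 => z0; rewrite betaE z0 -(scale0r 1) field_norm_scalar.
  by rewrite expf_eq0 eqxx adim_gt0.
have [[c c3]|/forallNP noncube] := pselect (exists c, c ^+ 3 = iv alpha).
  exact: (cube_local_norm v_prime Kv_completion eps_prim theta_cube L_gen beta c3).
have {}noncube c : c ^+ 3 != iv alpha by apply/eqP/noncube.
have [c0 [c1 [c2 ->]]] := symbol_not_division_norm noncube not_div.
exact: (noncube_local_norm v_prime Kv_completion eps_prim theta_cube L_gen c0 c1 c2 noncube).
Qed.
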